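(* Fix $0<p<1/2$. Suppose $\mu$ is a finite positive measure supported on a $(1-p)$-Beurling-Carleson set. If $S_\mu$ satisfies the $(1+p)$-area condition, that is, for every $0<c<1$, $$\int_{\{z\in\mathbb{D}:\ |S_\mu(z)|<c\}}\frac{dA(z)}{(1-|z|)^{1+p}}<\infty,$$ then $S_\mu'\in H^p$.
   Context: $\mathbb{D}$ is the open unit disk, $\partial\mathbb{D}$ the unit circle, $dA$ is area measure, $|J|$ is the length of an arc $J$, and $H^p$ is the Hardy space on $\mathbb{D}$. For a finite positive singular measure $\mu$ on $\partial\mathbb{D}$, the singular inner function is $$S_\mu(z)=\exp\Bigl(-\int_{\partial\mathbb{D}}\frac{\zeta+z}{\zeta-z}\,d\mu(\zeta)\Bigr),\qquad |z|<1.$$ For $0<\alpha<1$, an $\alpha$-Beurling-Carleson set is a closed subset $E\subset\partial\mathbb{D}$ of zero length whose complementary arcs $\{J\}$ (the connected components of $\partial\mathbb{D}\setminus E$) satisfy $\sum_J|J|^\alpha<\infty$. *)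

(* Defs.v *)
From HB Require Import structures.
From mathcomp Require Import all_boot all_order all_algebra.
From mathcomp Require Import all_classical all_reals all_analysis.
From mathcomp Require Export complex.

Set Implicit Arguments.
Unset Strict Implicit.
Unset Printing Implicit Defensive.

Import Order.TTheory GRing.Theory Num.Theory.
Import numFieldNormedType.Exports.

Local Open Scope classical_set_scope.
Local Open Scope ring_scope.
Local Open Scope complex_scope.

(* The plane appears both as R * R, which carries the Borel sigma-algebra, the
   Lebesgue measure and the measures mu, and as the field R[i], in which the
   analytic functions live; [toC] identifies the two. *)
Section Plane.
Variable R : realType.
Local Notation C := R[i].

Definition toC (w : R * R) : C := w.1 +i* w.2.

(* The norm of R[i] as a numFieldType takes values in R[i]; this one is real. *)
Definition cabs (z : C) : R := ComplexField.Normc.normc z.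

Definition cis (t : R) : C := cos t +i* sin t.

Definition cexp (z : C) : C := (expR (complex.Re z))%:C * cis (complex.Im z).

Definition unit_disk : set (R * R) := [set w | cabs (toC w) < 1].

Definition unit_circle : set (R * R) := [set w | cabs (toC w) = 1].

Definition arc_length (J : set (R * R)) : \bar R :=
  lebesgue_measure [set t : R | 0 <= t < 2 * pi /\ J (cos t, sin t)].

Definition complementary_arcs (E : set (R * R)) : set (set (R * R)) :=
  [set connected_component (unit_circle `\` E) w | w in unit_circle `\` E].

Definition beurling_carleson (alpha : R) (E : set (R * R)) : Prop :=
  [/\ E `<=` unit_circle, closed E, arc_length E = 0%E &
      (\esum_(J in complementary_arcs E) (arc_length J `^ alpha) < +oo)%E].

Definition Cintegral (mu : {measure set (R * R) -> \bar R})
    (D : set (R * R)) (f : R * R -> C) : C :=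
  (\int[mu]_(w in D) complex.Re (f w)) +i* (\int[mu]_(w in D) complex.Im (f w)).

Definition singular_inner (mu : {measure set (R * R) -> \bar R}) (z : C) : C :=
  cexp (- Cintegral mu unit_circle (fun w => (toC w + z) / (toC w - z))).

Definition area_condition (beta : R) (f : C -> C) : Prop :=
  forall c : R, 0 < c < 1 ->
    (\int[(@lebesgue_measure R \x @lebesgue_measure R)]_(w in
        [set w | unit_disk w /\ (cabs (f (toC w)) < c)%R])
       (((1 - cabs (toC w)) `^ beta)^-1)%:E < +oo)%E.

Definition cderiv (f : C -> C) : C -> C := derive1 (f : C -> C^o).

Definition hardy (p : R) (f : C -> C) : Prop :=
  (forall z : C, cabs z < 1 -> derivable (f : C^o -> C^o) z 1) /\
  (ereal_sup [set \int[@lebesgue_measure R]_(t in `[0%R, (2 * pi)%R])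
                    ((cabs (f (r%:C * cis t)) `^ p)%R)%:E
              | r in [set r : R | (0 <= r < 1)%R]] < +oo)%E.

End Plane.

(* Main.v *)
From HB Require Import structures.
Require Import Defs.
From mathcomp Require Import all_boot all_order all_algebra.
From mathcomp Require Import all_classical all_reals all_analysis.
From mathcomp Require Import measurable_realfun ring lra.
Import numFieldNormedType.Exports.
Local Open Scope classical_set_scope.
Local Open Scope ring_scope.
Set Implicit Arguments.
Unset Strict Implicit.
Unset Printing Implicit Defensive.
Import Order.TTheory GRing.Theory Num.Theory.

(** Write zeta = e^(it), d for the distance from zeta to E, and Q for the potential
    of mu at zeta, that is the integral of 1 / |w - zeta|^2 against mu, which is
    carried by E.

    Radial bound. As S' = - P' S, where P is the Herglotz integral of mu, and as
    |S| <= 1 and |w - zeta| <= 2 |w - r zeta|, one has |S'(r zeta)| <= 16 Q for every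
    0 <= r < 1 ([cabs_cderiv_singular_inner_le]). So it suffices to bound the
    integral of Q^p over the circle.

    Pointwise estimate. Let h = 2^-n. In a square of side comparable with h around
    (1 - h) zeta the Poisson integral - log |S| is at least h Q / 8 as long as h <= d.
    Therefore, if h <= d and 8 <= h Q, the square is contained in the sublevel set
    A = {|S| < 3/4} ([cabs_singular_inner_box]). Taking h as small as 8 <= h Q permits,
    one finds that Q^p is at most a constant times d^-p plus the sum of 2^(np) over
    the generations n whose square lies in A ([powR_dyadic_cover]).

    The first term. E is null, and on a complementary arc J the distance to E is at
    least the distance to one of the two ends of J, so that d^-p has integral
    O(|J|^(1-p)) over J; the sum over J is finite by the Beurling-Carleson condition
    ([integral_circ_dist_lty]). The ends are found from the nearest angles of E, and
    that the connected component is the arc between them is an argument with the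
    chord through the ends ([component_chord_height]).

    The second term. By Tonelli's theorem its integral in t is at most a constant
    times the integral of (1 - |w|)^-(1+p) over A ([integral_sum_box_density]), which
    is finite by the area condition with c = 3/4.

    The derivatives of S are computed from expansions with a quadratic remainder,
    which pass from the kernels to the integrals and through the exponential. *)

(** * Moduli, angles and chords on the unit circle *)

Arguments cabs : simpl never.
Arguments cis : simpl never.
Arguments toC : simpl never.

Section CircleGeometry.
Variable R : realType.
Implicit Types (z w : R[i]) (s t u v x : R).

Lemma cabs_ge0 z : 0 <= cabs z.
Proof. by case: z => a b; rewrite /cabs /= sqrtr_ge0. Qed.

Lemma cabs2 z : cabs z ^+ 2 = complex.Re z ^+ 2 + complex.Im z ^+ 2.
Proof. by case: z => a b; rewrite /cabs /= sqr_sqrtr // addr_ge0 // sqr_ge0. Qed.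

Lemma cabsE (z : R[i]) : `|z| = ((cabs z)%:C)%C.
Proof. by case: z => a b; rewrite normc_def. Qed.

Lemma cabsD z w : cabs (z + w) <= cabs z + cabs w.
Proof. exact: le_normcD. Qed.

Lemma cabsM z w : cabs (z * w) = cabs z * cabs w.
Proof. exact: ComplexField.Normc.normcM. Qed.

Lemma cabsV z : cabs z^-1 = (cabs z)^-1.
Proof. exact: ComplexField.Normc.normcV. Qed.

Lemma cabsN z : cabs (- z) = cabs z.
Proof. exact: normcN. Qed.

Lemma cabsC z w : cabs (z - w) = cabs (w - z).
Proof. by rewrite -cabsN opprB. Qed.

Lemma cabs_triangle y z w : cabs (z - w) <= cabs (z - y) + cabs (y - w).
Proof. by rewrite -[X in cabs X <= _](subrKA y) ; exact: cabsD. Qed.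

Lemma cabs_eq0 z : (cabs z == 0) = (z == 0).
Proof.
apply/eqP/eqP => [|->]; first exact: ComplexField.Normc.eq0_normc.
exact: ComplexField.Normc.normc0.
Qed.

Lemma cabs0 : cabs (0 : R[i]) = 0.
Proof. exact: ComplexField.Normc.normc0. Qed.

Lemma cabs_gt0 z : (0 < cabs z) = (z != 0).
Proof. by rewrite lt_neqAle cabs_ge0 andbT eq_sym cabs_eq0. Qed.

Lemma cabs_cis t : cabs (cis t) = 1.
Proof. by rewrite /cabs /= cos2Dsin2 sqrtr1. Qed.

Lemma cabs_real (x : R) : cabs (x%:C)%C = `|x|.
Proof. by rewrite /cabs /= expr0n addr0 sqrtr_sqr. Qed.

Lemma chord2 s t : cabs (cis s - cis t) ^+ 2 = 2 - 2 * cos (s - t).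
Proof.
rewrite cabs2 /= cosB.
have := cos2Dsin2 s; have := cos2Dsin2 t; lra.
Qed.

Lemma le_cabs z w : (cabs z <= cabs w) = (cabs z ^+ 2 <= cabs w ^+ 2).
Proof. by rewrite ler_pXn2r // nnegrE cabs_ge0. Qed.

Lemma le_chord s t s' t' : cos (s' - t') <= cos (s - t) ->
  cabs (cis s - cis t) <= cabs (cis s' - cis t').
Proof. by move=> h; rewrite le_cabs !chord2; lra. Qed.

Lemma cisD s t : cis (s + t) = cis s * cis t.
Proof.
by apply/eqP; rewrite eq_complex /cis /= cosD sinD eqxx /= addrC.
Qed.

Lemma circle_angle0 z : cabs z = 1 -> exists2 u, - pi <= u <= pi & z = cis u.
Proof.
case: z => a b h; have := cabs2 (a +i* b)%C; rewrite h /= => h2.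
have a1 : -1 <= a <= 1 by apply/andP; split; nra.
have sa : sin (acos a) = `|b|.
  by rewrite sin_acos // -(sqrtr_sqr b); congr Num.sqrt; lra.
have := acos_ge0 a1; have := acos_lepi a1; have := pi_ge0 R => p0 h3 h4.
have [b0|b0] := leP 0 b.
  exists (acos a); first by apply/andP; split; lra.
  by rewrite /cis acosK // sa ger0_norm.
exists (- acos a); first by apply/andP; split; lra.
by rewrite /cis cosN sinN acosK // sa ltr0_norm // opprK.
Qed.

(** The angle is measured from an arbitrary base point: arcs are described below
    by their midpoint and half length. *)
Lemma circle_angle (m : R) z :
  cabs z = 1 -> exists2 u, - pi <= u <= pi & z = cis (m + u).
Proof.
move=> h; have [|u hu e] := @circle_angle0 (cis (- m) * z).
  by rewrite cabsM cabs_cis mul1r.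
exists u => //; rewrite cisD -e mulrA -cisD addrN.
by rewrite /cis cos0 sin0 -/(1 : R[i]) mul1r.
Qed.

Lemma cis_periodic s : cis (s + pi *+ 2) = cis s.
Proof. by rewrite /cis cosD2pi sinD2pi. Qed.

Lemma mul_cos_le_sin x : 0 <= x <= pi / 2 -> x * cos x <= sin x.
Proof.
move=> /andP[]; rewrite le_eqVlt => /predU1P[<- _|x0 xpi].
  by rewrite mul0r sin0.
have [y /[!in_itv]/= /andP[y0 yx]] := @MVT R sin cos 0 x x0
  (fun y _ => is_derive_sin y) (continuous_subspaceT (@continuous_sin R)).
rewrite sin0 !subr0 => ->; rewrite mulrC ler_wpM2r ?(ltW x0) //.
have := pi_ge0 R => p0.
have xI : x \in `[0, pi] by rewrite in_itv /=; apply/andP; split; lra.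
have yI : y \in `[0, pi] by rewrite in_itv /=; apply/andP; split; lra.
by rewrite leNgt ltr_cos // -leNgt ltW.
Qed.

(** Halving the angle once more than in the formula for the chord gives
    sin (x / 2) >= x / 4 on [0, pi], a cheap substitute for the concavity of sin. *)
Lemma sin_half_ge x : 0 <= x <= pi -> x / 4 <= sin (x / 2).
Proof.
move=> /andP[x0 xpi]; have p0 : 0 <= pi :> R by exact: pi_ge0.
have -> : x / 2 = (x / 4) *+ 2 by rewrite -[RHS]mulr_natr; lra.
rewrite sin_mulr2n.
have h : (x / 4) * cos (x / 4) <= sin (x / 4).
  by apply: mul_cos_le_sin; apply/andP; split; lra.
have c2 : 1 / 2 <= cos (x / 4) ^+ 2.
  have := cos_mulr2n (x / 4); rewrite -[_ ^+ 2 *+ 2]mulr_natr.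
  have : 0 <= cos (x / 4 *+ 2).
    by apply: cos_ge0_pihalf; rewrite -[x / 4 *+ 2]mulr_natr; apply/andP; split; lra.
  lra.
have c0 : 0 <= cos (x / 4) by apply: cos_ge0_pihalf; apply/andP; split; lra.
rewrite -[leRHS]mulr_natr; move: (cos _) (sin _) c0 c2 h => c d; nra.
Qed.

Lemma chord_ge s t : `|s - t| <= pi -> `|s - t| / 2 <= cabs (cis s - cis t).
Proof.
move=> xpi.
suff : (`|s - t| / 2) ^+ 2 <= cabs (cis s - cis t) ^+ 2.
  by rewrite ler_pXn2r // nnegrE ?cabs_ge0 // divr_ge0.
rewrite chord2 -(cos_norm (s - t)).
move: xpi (normr_ge0 (s - t)); move: `|s - t| => x xpi x0.
have h : x / 4 <= sin (x / 2) by apply: sin_half_ge; rewrite x0.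
have -> : x = (x / 2) *+ 2 by rewrite -[RHS]mulr_natr; lra.
rewrite cos_mulr2n -[_ ^+ 2 *+ 2]mulr_natr -[_ *+ 2]mulr_natr.
have := cos2Dsin2 (x / 2); move: (cos _) (sin _) h => c d; nra.
Qed.

Lemma measure_itv_center (c e : R) : 0 <= e ->
  lebesgue_measure (`[c - e, c + e] : set R) = (2 * e)%:E.
Proof.
move=> e0; rewrite lebesgue_measure_itv /= lte_fin.
case: ifPn => h; first by rewrite -EFinB; congr EFin; lra.
by congr EFin; lra.
Qed.

(** Two angles of T differ by at most 2 e up to a full turn, because a chord
    controls its arc. Hence T lies in three intervals of length 4 e, centred at one
    of its points and at the two translates of that point by a full turn. *)
Lemma measure_angles_le_diam (T : set R) (e : R) : 0 <= e -> measurable T ->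
  T `<=` `[0, pi *+ 2] ->
  (forall s t, T s -> T t -> cabs (cis s - cis t) <= e) ->
  (lebesgue_measure T <= (12 * e)%:E)%E.
Proof.
move=> e0 mT Tpi Te.
have [->|/set0P[s0 Ts0]] := eqVneq T set0.
  by rewrite measure0 lee_fin; lra.
pose I c : set R := [set` `[c - 2 * e, c + 2 * e]].
have mI c : measurable (I c) by exact: measurable_itv.
have mIE c : (lebesgue_measure (I c) <= (4 * e)%:E)%E.
  rewrite measure_itv_center ?lee_fin; lra.
have near c s : T s -> cis c = cis s0 -> `|s - c| <= pi -> I c s.
  move=> Ts cE /chord_ge; rewrite cE => h.
  have := le_trans h (Te _ _ Ts Ts0).
  rewrite /I /= in_itv /= -ler_distl => ?; lra.
have sub : T `<=` I s0 `|` (I (s0 + pi *+ 2) `|` I (s0 - pi *+ 2)).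
  move=> s Ts; move: (Tpi _ Ts) (Tpi _ Ts0); rewrite /= !in_itv /=.
  rewrite -[pi *+ 2 in X in X -> _]mulr_natr -[pi *+ 2 in X in _ -> X -> _]mulr_natr.
  move=> /andP[s1 s2] /andP[s3 s4].
  have E2 : pi *+ 2 = pi * 2 :> R by rewrite mulr_natr.
  have [h|h] := leP `|s - s0| pi; first by left; apply: near.
  move: h; rewrite ltr_normr => /orP[] h; right; [left|right].
    apply: near => //; first by exact: cis_periodic.
    by rewrite E2 ler_norml; apply/andP; split; lra.
  apply: near => //.
    by rewrite -[LHS]cis_periodic subrK.
  by rewrite E2 ler_norml; apply/andP; split; lra.
apply: (@le_trans _ _ (lebesgue_measure (I s0 `|` (I (s0 + pi *+ 2) `|` I (s0 - pi *+ 2))))).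
  apply: le_measure => //; rewrite inE //.
  exact: measurableU (mI _) (measurableU _ _ (mI _) (mI _)).
apply: (le_trans (measureU2 _ _ _)); [exact: mI|exact: measurableU (mI _) (mI _)|].
apply: (@le_trans _ _ ((4 * e)%:E + ((4 * e)%:E + (4 * e)%:E))%E).
  apply: leeD; first exact: mIE.
  apply: (le_trans (measureU2 _ _ _)); [exact: mI|exact: mI|].
  by apply: leeD; exact: mIE.
by rewrite -!EFinD lee_fin; lra.
Qed.
End CircleGeometry.

(** * Complementary arcs of a closed subset of the circle *)

Section Components.
Variable R : realType.
Implicit Types (z w : R * R) (s t u v x m L : R) (E : set (R * R)).

Definition circ t : R * R := (cos t, sin t).

Lemma toC_circ t : toC (circ t) = cis t.
Proof. by []. Qed.

Lemma continuous_circ : continuous circ.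
Proof.
move=> t; rewrite /circ /continuous_at.
exact: (cvg_pair (@continuous_cos R t) (@continuous_sin R t)).
Qed.

Lemma circ_angle m w : unit_circle w ->
  exists2 u, - pi <= u <= pi & w = circ (m + u).
Proof.
case: w => a b /(circle_angle m)[u hu [-> ->]]; by exists u.
Qed.

Definition chord_height m w := w.1 * cos m + w.2 * sin m.

Lemma chord_height_circ m t : chord_height m (circ t) = cos (t - m).
Proof. by rewrite cosB. Qed.

Lemma continuous_chord_height m : continuous (chord_height m).
Proof.
move=> w; apply: cvgD; apply: cvgMl; [exact: cvg_fst|exact: cvg_snd].
Qed.

Lemma unit_circle_circ t : unit_circle (circ t).
Proof. exact: cabs_cis. Qed.

Lemma closed_last_before (F : set R) t : closed F -> (exists2 a, F a & a <= t) ->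
  exists a, [/\ F a, a <= t & forall x, a < x <= t -> ~ F x].
Proof.
move=> cF [a0 Fa0 a0t]; pose A := F `&` [set x | x <= t].
have ubA : ubound A t by move=> x [].
have A0 : A !=set0 by exists a0.
have hA : has_ubound A by exists t.
have [Fa ta] : A (sup A).
  by apply: (closedI cF (@closed_le _ t)); exact: closure_sup.
exists (sup A); split => // x /andP[ax xt] Fx.
by have := ub_le_sup hA (conj Fx xt); rewrite leNgt ax.
Qed.

(** The gap around the angle t0 is bounded by the last angle of E before t0 and the
    first one after t0. By periodicity these are at most a full turn apart, so the
    half length L is at most pi. *)
Lemma complementary_gap E t0 : closed E -> E `<=` @unit_circle R -> E !=set0 ->
  ~ E (circ t0) ->
  exists m L, [/\ 0 < L <= pi, E (circ (m - L)), E (circ (m + L)),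
    `|t0 - m| < L & forall u, `|u| < L -> ~ E (circ (m + u))].
Proof.
move=> cE Ec [w Ew] nE.
pose F := [set x | E (circ x)].
have cF : closed F by apply: closed_comp => //; move=> x _; exact: continuous_circ.
have per x : F x -> F (x + pi *+ 2).
  by rewrite /F /= /circ cosD2pi sinD2pi.
have perN x : F x -> F (x - pi *+ 2).
  by move=> h; rewrite /F /= /circ -cosD2pi -sinD2pi subrK.
have pi0 := pi_gt0 R; have E2 : pi *+ 2 = pi * 2 :> R by rewrite mulr_natr.
have [e Fe et0] : exists2 e, F e & t0 - pi <= e <= t0 + pi.
  have [u hu wE] := circ_angle t0 (Ec _ Ew); exists (t0 + u).
    by rewrite /F /= -wE.
  lra.
have nF : ~ F t0 by [].
have [a [Fa at0 aF]] : exists a, [/\ F a, a <= t0 & forall x, a < x <= t0 -> ~ F x].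
  apply: closed_last_before => //; have [h|h] := leP e t0; first by exists e.
  by exists (e - pi *+ 2); [exact: perN|rewrite E2; lra].
have [b [Fb bt0 bF]] : exists b, [/\ F b, t0 <= b & forall x, t0 <= x < b -> ~ F x].
  have [||b' [Fb' b't0 b'F]] := @closed_last_before [set x | F (- x)] (- t0).
  - apply: closed_comp => //; move=> x _; exact: opp_continuous.
  - have [h|h] := leP t0 e.
      by exists (- e); rewrite /= ?opprK // lerN2.
    by exists (- (e + pi *+ 2)); rewrite /= ?opprK; [exact: per|rewrite E2; lra].
  - exists (- b'); split; [exact: Fb'|lra|] => x hx.
    by rewrite -(opprK x); apply: b'F; lra.
have {}at0 : a < t0.
  by rewrite lt_neqAle at0 andbT; apply/eqP => ?; subst a.
have {}bt0 : t0 < b.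
  by rewrite lt_neqAle bt0 andbT; apply/eqP => ?; subst b.
have abF x : a < x < b -> ~ F x.
  by have [xt|xt] := leP x t0 => /andP[ax xb]; [apply: aF|apply: bF]; lra.
have ab : b <= a + pi * 2.
  rewrite leNgt; apply/negP => h; apply: (abF (a + pi *+ 2)); last exact: per.
  rewrite E2; lra.
exists ((a + b) / 2), ((b - a) / 2); split.
- lra.
- by rewrite (_ : _ - _ = a); [|lra].
- by rewrite (_ : _ + _ = b); [|lra].
- by rewrite ltr_distl; lra.
- by move=> u; rewrite ltr_norml => hu; apply: abF; lra.
Qed.
Lemma cos_gt_abs (u L : R) : `|u| <= pi -> 0 <= L <= pi ->
  (cos L < cos u) = (`|u| < L).
Proof.
move=> hu hL; by rewrite -(cos_norm u) ltr_cos // in_itv /= ?normr_ge0.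
Qed.

(** The chord through the two ends of the gap cuts the arc off the rest of the
    circle: by connectedness a component meeting both sides would contain a point of
    height cos L, and the only such points of the circle are the two ends, which
    belong to E. So the topological component is an explicit open arc. *)
Lemma component_chord_height E t0 m L : E `<=` @unit_circle R -> 0 < L <= pi ->
  E (circ (m - L)) -> E (circ (m + L)) -> `|t0 - m| < L ->
  (forall u, `|u| < L -> ~ E (circ (m + u))) ->
  connected_component (@unit_circle R `\` E) (circ t0) =
  [set w | unit_circle w /\ cos L < chord_height m w].
Proof.
move=> Ec hL Em Ep t0L nE.
have height0 : cos L < chord_height m (circ t0).
  rewrite chord_height_circ cos_gt_abs //; last lra.
  apply: (le_trans (ltW t0L)); lra.
have Wt0 : (@unit_circle R `\` E) (circ t0).
  by split; [exact: unit_circle_circ|rewrite -(subrKC m t0); exact: nE].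
apply/seteqP; split=> w /=.
  move=> Jw; have [cw nEw] : (@unit_circle R `\` E) w by exact: connected_component_sub Jw.
  split => //; rewrite ltNge; apply/negP => hw.
  pose J := connected_component (@unit_circle R `\` E) (circ t0).
  have cJ : connected [set chord_height m x | x in J].
    apply: connected_continuous_connected; first exact: component_connected.
    by apply: continuous_subspaceT; exact: continuous_chord_height.
  move/connected_intervalP : cJ => /(_ (chord_height m w) (chord_height m (circ t0))).
  case/(_ _ _ (cos L)).
  - by exists w.
  - exists (circ t0) => //; exact: connected_component_refl.
  - by rewrite hw ltW.
  move=> y Jy hy; have [cy nEy] : (@unit_circle R `\` E) y by exact: connected_component_sub Jy.
  have [u hu yE] := circ_angle m cy.
  move: hy; rewrite yE chord_height_circ addrAC subrr add0r -cos_norm.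
  have hu' : `|u| <= pi by rewrite ler_norml; lra.
  move=> /cos_inj; rewrite !in_itv /= => uL; move: nEy; rewrite yE.
  have := normr_ge0 u => ?.
  have {uL} : `|u| = L by apply: uL; lra.
  have [u0|u0] := leP 0 u => uL; apply; first by rewrite -(ger0_norm u0) uL.
  by rewrite (_ : u = - L) // -uL ltr0_norm // opprK.
move=> [cw hw]; have [u hu wE] := circ_angle m cw.
have hu' : `|u| <= pi by rewrite ler_norml; lra.
move: hw; rewrite wE chord_height_circ addrAC subrr add0r cos_gt_abs //; last lra.
move=> uL; apply: (@connected_component_max _ _ (circ @` `]m - L, m + L[)).
- by exists t0 => //=; rewrite in_itv /= -ltr_distl.
- move=> _ /= [x + <-]; rewrite in_itv /= -ltr_distl => xL; split; first exact: unit_circle_circ.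
  by rewrite -(subrKC m x); exact: nE.
- apply: connected_continuous_connected; last first.
    by apply: continuous_subspaceT; exact: continuous_circ.
  by apply/connected_intervalP; exact: interval_is_interval.
- by exists (m + u) => //=; rewrite in_itv /= -ltr_distl addrAC subrr add0r.
Qed.

(** On the way from z to a point of E one passes an end of the gap, and a chord
    increases with its angle as long as the angle is at most pi. If the way through
    one end is longer than pi, then the way through the other one is shorter. *)
Lemma chord_ge_gap_ends E m L z w : E `<=` @unit_circle R -> 0 < L <= pi ->
  (forall u, `|u| < L -> ~ E (circ (m + u))) ->
  unit_circle z -> cos L < chord_height m z -> E w ->
  Num.min (cabs (toC z - cis (m - L))) (cabs (toC z - cis (m + L)))
    <= cabs (toC z - toC w).
Proof.
move=> Ec hL nE cz hz Ew; have [u hu zE] := circ_angle m cz.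
have hu' : `|u| <= pi by rewrite ler_norml; lra.
move: hz; rewrite zE chord_height_circ addrAC subrr add0r cos_gt_abs //; last lra.
rewrite ltr_norml => uL.
have [v hv wE] := circ_angle m (Ec _ Ew).
have vL : ~~ (`|v| < L).
  by apply/negP => vL; apply: (nE v vL); rewrite -wE.
rewrite wE !toC_circ ge_min.
have pi0 := pi_gt0 R; have E2 : pi *+ 2 = pi * 2 :> R by rewrite mulr_natr.
have cos_anti (x y : R) : 0 <= x -> x <= y -> y <= pi -> cos y <= cos x.
  by move=> x0 xy yp; rewrite leNgt ltr_cos ?in_itv /= -?leNgt //; lra.
move: vL; rewrite -leNgt ler_normr => /orP[] vL.
- have [h|h] := leP (v - u) pi; apply/orP; [right|left]; apply: le_chord.
    rewrite -cosN -[leRHS]cosN; apply: cos_anti; lra.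
  rewrite -cosD2pi; apply: cos_anti; lra.
- have [h|h] := leP (u - v) pi; apply/orP; [left|right]; apply: le_chord.
    apply: cos_anti; lra.
  rewrite -cosN -[leLHS]cosD2pi -[leRHS]cosN; apply: cos_anti; lra.
Qed.
End Components.

(** * Nonnegative integrals and series *)

Section IntegralTools.
Local Open Scope ereal_scope.

(** The integral of a nonnegative function is the supremum of the integrals of the
    simple functions below it; this makes it monotone on all nonnegative functions. *)
Lemma le_integral_pointwise d (T : measurableType d) (R : realType)
    (mu : {measure set T -> \bar R}) (D : set T) (f g : T -> \bar R) :
  (forall x, D x -> 0 <= f x) -> (forall x, D x -> f x <= g x) ->
  \int[mu]_(x in D) f x <= \int[mu]_(x in D) g x.
Proof.
move=> f0 fg; have g0 x : D x -> 0 <= g x by move=> Dx; exact: le_trans (f0 _ Dx) (fg _ Dx).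
rewrite !(integral_mkcond D) !ge0_integralTE; last 2 first.
- by move=> x; exact: erestrict_ge0.
- by move=> x; exact: erestrict_ge0.
apply: ereal_sup_le => _ [h hf <-]; exists h => // x.
apply: (le_trans (hf x)); rewrite /patch; case: ifPn => // /set_mem; exact: fg.
Qed.

Lemma nneseries_term (R : realType) (u : (\bar R)^nat) (k : nat) :
  (forall n, 0 <= u n) -> u k <= \sum_(n <oo) u n.
Proof.
move=> u0; apply: le_trans (@nneseries_lim_ge _ u xpredT 0 k.+1 (fun n _ _ => u0 n)).
by rewrite big_nat_recr //= leeDr // sume_ge0.
Qed.

Lemma nneseries_geometric (R : realType) (a q : R) : (0 <= q < 1)%R ->
  \sum_(n <oo) (a * q ^+ n)%:E = (a / (1 - q))%:E.
Proof.
move=> /andP[q0 q1]; apply/cvg_lim => //.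
rewrite (_ : (fun n => _) = EFin \o series (geometric a q)); last first.
  by apply/funext => n /=; rewrite sumEFin.
by apply: cvg_EFin; [exact: nearW|apply: cvg_geometric_series; rewrite ger0_norm].
Qed.

Lemma measurable_set_ler d (T : measurableType d) (R : realType) (f g : T -> R) :
  measurable_fun setT f -> measurable_fun setT g -> measurable [set x | (f x <= g x)%R].
Proof.
move=> mf mg; rewrite -[X in measurable X]setTI.
by have := measurable_fun_ler mf mg measurableT; apply.
Qed.

Lemma measurable_set_ltr d (T : measurableType d) (R : realType) (f g : T -> R) :
  measurable_fun setT f -> measurable_fun setT g -> measurable [set x | (f x < g x)%R].
Proof.
move=> mf mg; rewrite -[X in measurable X]setTI.
by have := measurable_fun_ltr mf mg measurableT; apply.
Qed.

Lemma measurable_fun_nneseries d (T : measurableType d) (R : realType)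
    (D : set T) (h : nat -> T -> \bar R) :
  (forall k x, 0 <= h k x) -> (forall k, measurable_fun D (h k)) ->
  measurable_fun D (fun x => \sum_(k <oo) h k x).
Proof.
move=> h0 mh; exact: (@ge0_emeasurable_sum _ _ _ D h xpredT).
Qed.

End IntegralTools.

(** * Powers of two and dyadic decompositions of a power *)

Section Dyadic.
Variable R : realType.
Implicit Types (x L p : R).

Definition dyad k : R := 2^-1 ^+ k.

Lemma dyad_gt0 k : 0 < dyad k.
Proof. by rewrite exprn_gt0. Qed.

Lemma dyadS k : dyad k.+1 = dyad k / 2.
Proof. by rewrite /dyad exprSr. Qed.

Lemma dyad0 : dyad 0 = 1.
Proof. by rewrite /dyad expr0. Qed.

Lemma dyad_le1 k : dyad k <= 1.
Proof. by rewrite exprn_ile1 //; lra. Qed.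

Lemma dyad_powR k p : dyad k `^ p = (2^-1 `^ p) ^+ k.
Proof. by rewrite /dyad -!powR_mulrn ?powR_ge0 // powRAC. Qed.

Lemma dyad_small x : 0 < x -> exists k, dyad k <= x.
Proof.
move=> x0.
have /cvgrPdist_le /(_ x x0) [k _ /(_ k (leqnn k))] : geometric 1 2^-1 @ \oo --> (0 : R).
  by apply: cvg_geometric; rewrite ger0_norm //; lra.
by rewrite sub0r normrN /geometric /= mul1r => h; exists k; apply: le_trans (ler_norm _) h.
Qed.

Lemma powRD_gt0 x p q : 0 < x -> x `^ (p + q) = x `^ p * x `^ q.
Proof. by move=> x0; rewrite powRD // (gt_eqF x0) implybT. Qed.

Lemma powRN_anti x y p : 0 <= p -> 0 < x -> x <= y -> y `^ (- p) <= x `^ (- p).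
Proof.
move=> p0 x0 xy; have y0 : 0 < y by exact: lt_le_trans xy.
rewrite !powRN lef_pV2 ?posrE ?powR_gt0 //.
by apply: ge0_ler_powR => //; rewrite nnegrE ltW.
Qed.

(** Dyadic layers at scale L: a point with 0 < x < L lies in one of the shells
    2^-(k+1) L <= x <= 2^-k L, on which x^-p is at most its value at the inner edge. *)
Lemma powRN_dyadic x L p : 0 < p -> 0 <= x -> 0 < L ->
  ((x `^ (- p))%:E <= (L `^ (- p))%:E +
    \sum_(k <oo) ((dyad k.+1 * L) `^ (- p) * (x <= dyad k * L)%R%:R)%:E)%E.
Proof.
move=> p0 + L0; rewrite le_eqVlt => /predU1P[<-|x0].
  rewrite powR0 ?oppr_eq0 ?gt_eqF // adde_ge0 ?lee_fin ?powR_ge0 //.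
  by apply: nneseries_ge0 => *; rewrite lee_fin mulr_ge0 ?powR_ge0.
have s0 : (0 <= \sum_(k <oo) ((dyad k.+1 * L) `^ (- p) * (x <= dyad k * L)%R%:R)%:E)%E.
  by apply: nneseries_ge0 => *; rewrite lee_fin mulr_ge0 ?powR_ge0.
have [Lx|xL] := leP L x.
  by rewrite -[leLHS]adde0 leeD // lee_fin powRN_anti // ltW.
(* the first k with 2^-(k+1) L <= x *)
have [|k0 hk0] := @dyad_small (x / L); first by rewrite divr_gt0.
have ex : exists k, dyad k.+1 * L <= x.
  exists k0; rewrite -ler_pdivlMr // (le_trans _ hk0) // dyadS.
  by have := dyad_gt0 k0; lra.
have [k hk kmin] := ex_minnP ex.
have xk : x <= dyad k * L.
  case: k hk kmin => [_ _|k _ kmin]; first by rewrite dyad0 mul1r ltW.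
  by rewrite leNgt; apply/negP => /ltW /kmin; rewrite ltnn.
rewrite -[leLHS]add0e; apply: leeD; first by rewrite lee_fin powR_ge0.
apply: (@le_trans _ _ ((dyad k.+1 * L) `^ (- p) * (x <= dyad k * L)%R%:R)%:E); last first.
  apply: (@nneseries_term _ (fun k => ((dyad k.+1 * L) `^ (- p) * (x <= dyad k * L)%R%:R)%:E)).
  by move=> n; rewrite lee_fin mulr_ge0 ?powR_ge0.
by rewrite xk mulr1 lee_fin powRN_anti ?(ltW p0) ?mulr_gt0 ?dyad_gt0.
Qed.

End Dyadic.

(** * Integrals of powers of a chord *)

Section ChordIntegral.
Variable R : realType.
Notation lambda := (@lebesgue_measure R).

Lemma continuous_chord (a : R[i]) : continuous (fun s : R => cabs (cis s - a)).
Proof.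
case: a => a b s.
apply: (@continuous_comp _ _ _ (fun s => (cos s - a) ^+ 2 + (sin s - b) ^+ 2) Num.sqrt).
  apply: cvgD.
    apply: (@continuous_comp _ _ _ (fun s => cos s - a) (fun x => x ^+ 2)).
      by apply: cvgB; [exact: continuous_cos|exact: cvg_cst].
    exact: exprn_continuous.
  apply: (@continuous_comp _ _ _ (fun s => sin s - b) (fun x => x ^+ 2)).
    by apply: cvgB; [exact: continuous_sin|exact: cvg_cst].
  exact: exprn_continuous.
exact: sqrt_continuous.
Qed.

Lemma measurable_chord (a : R[i]) (D : set R) :
  measurable_fun D (fun s : R => cabs (cis s - a)).
Proof.
apply: (measurable_funS _ (subsetT D)) => //.
by apply: continuous_measurable_fun; exact: continuous_chord.
Qed.

Lemma measure_chord_le (a : R[i]) (T : set R) (e : R) : 0 <= e ->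
  measurable T -> T `<=` `[0, pi *+ 2] ->
  (lambda (T `&` [set s | (cabs (cis s - a) <= e)%R]) <= (24 * e)%:E)%E.
Proof.
move=> e0 mT Tpi; rewrite (_ : 24 * e = 12 * (2 * e)); last lra.
apply: measure_angles_le_diam; first lra.
- by apply: measurableI => //; apply: measurable_set_ler => //; exact: measurable_chord.
- by move=> s [/Tpi].
- move=> s t [_ /= sa] [_ /= ta]; apply: (le_trans (@cabs_triangle R a _ _)).
  by rewrite (cabsC a); lra.
Qed.

(** Bathtub principle: where the chord exceeds the length L of T the integrand is at
    most L^-p, and the shell at distance 2^-k L from a has length O(2^-k L), so that
    the shells sum up to a geometric series of ratio 2^(p-1) times L^(1-p). *)
Lemma integral_chord_powRN (p : R) : 0 < p < 1 -> exists2 C : R, 0 <= C &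
  forall (a : R[i]) (T : set R), measurable T -> T `<=` `[0, pi *+ 2] ->
  (\int[lambda]_(s in T) (cabs (cis s - a) `^ (- p))%R%:E
     <= C%:E * lambda T `^ (1 - p))%E.
Proof.
move=> /andP[p0 p1]; pose q : R := 2^-1 `^ (1 - p).
have q1 : 0 <= q < 1.
  have : q < 1 `^ (1 - p) by apply: gt0_ltr_powR; rewrite ?nnegrE //; lra.
  by rewrite powR1 powR_ge0.
pose c : R := 24 * 2^-1 `^ (- p).
have c0 : 0 <= c by rewrite mulr_ge0 // powR_ge0.
exists (1 + c / (1 - q)).
  by rewrite addr_ge0 // divr_ge0 //; lra.
move=> a T mT Tpi.
have [T0|T0] := eqVneq (lambda T) 0%E.
  rewrite T0 poweR0r ?mule0; last lra.
  rewrite null_set_integral //; apply/measurable_EFinP.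
  apply: (measurableT_comp (measurable_powR _)); exact: measurable_chord.
have Tfin : lambda T \is a fin_num.
  rewrite ge0_fin_numE // (@le_lt_trans _ _ (lambda `[0, pi *+ 2])) //.
    by apply: le_measure; rewrite ?inE.
  by rewrite lebesgue_measure_itv /=; case: ifP; rewrite ?ltry // oppr0 addr0 ltry.
move: Tfin (T0) => /fineK TE; rewrite -TE poweR_EFin -EFinM.
set L := fine (lambda T) => {}T0.
have L0 : 0 < L by rewrite lt_neqAle eq_sym fine_ge0 // andbT; move: T0; rewrite eqe.
pose f k s : \bar R := ((dyad R k.+1 * L) `^ (- p) * (cabs (cis s - a) <= dyad R k * L)%R%:R)%:E.
have f0 k s : (0 <= f k s)%E by rewrite lee_fin mulr_ge0 // powR_ge0.
have mA k : measurable [set s | cabs (cis s - a) <= dyad R k * L].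
  by apply: measurable_set_ler => //; exact: measurable_chord.
have fE k : f k = (fun s => ((dyad R k.+1 * L) `^ (- p))%:E *
    (\1_[set s | (cabs (cis s - a) <= dyad R k * L)%R] s)%:E)%E.
  by apply/funext => s; rewrite /f -EFinM indicE mem_setE.
have mf k : measurable_fun T (f k).
  rewrite fE; apply: measurable_funeM; apply/measurable_EFinP.
  by apply: measurable_funTS; apply: measurable_indic; exact: mA.
apply: (@le_trans _ _ (\int[lambda]_(s in T) ((L `^ (- p))%:E + \sum_(k <oo) f k s)))%E.
  apply: le_integral_pointwise => s _; first by rewrite lee_fin powR_ge0.
  by apply: powRN_dyadic => //; exact: cabs_ge0.
rewrite ge0_integralD //; last 3 first.
- by move=> *; rewrite lee_fin powR_ge0.
- by move=> *; exact: nneseries_ge0.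
- exact: measurable_fun_nneseries.
rewrite integral_cst // [X in (_ * X + _)%E](_ : _ = L%:E) // integral_nneseries //.
apply: (@le_trans _ _ ((L `^ (1 - p))%:E + \sum_(k <oo) (c * L `^ (1 - p) * q ^+ k)%R%:E))%E.
  apply: leeD.
    by rewrite -EFinM lee_fin addrC powRD_gt0 // powRr1 ?(ltW L0).
  apply: lee_nneseries => k _; first by move=> *; exact: integral_ge0.
  rewrite fE ge0_integralZl //; last 2 first.
  - by apply/measurable_EFinP/measurable_funTS; apply: measurable_indic; exact: mA.
  - by rewrite lee_fin powR_ge0.
  rewrite integral_indic; [|exact: mT|exact: mA]; rewrite setIC.
  apply: (@le_trans _ _ (((dyad R k.+1 * L) `^ (- p))%:E * (24 * (dyad R k * L))%:E))%E.
    apply: lee_pmul => //; first by rewrite lee_fin powR_ge0.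
    by apply: measure_chord_le => //; rewrite mulr_ge0 // ltW // dyad_gt0.
  rewrite -EFinM lee_fin.
  rewrite dyadS (_ : dyad R k / 2 * L = dyad R k * (2^-1 * L)); last by field.
  rewrite powRM ?(ltW (dyad_gt0 _ _)) // ?mulr_ge0 ?(ltW L0) //.
  rewrite powRM ?(ltW L0) // /c /q -dyad_powR addrC !powRD_gt0 ?dyad_gt0 //.
  rewrite !powRr1 ?(ltW L0) ?(ltW (dyad_gt0 _ _)) // le_eqVlt; apply/orP; left; apply/eqP; ring.
rewrite nneseries_geometric // -EFinD lee_fin.
by rewrite mulrDl mul1r lerD2l mulrAC.
Qed.

End ChordIntegral.

(** * Powers of the distance to a Beurling-Carleson set *)

Section DistanceIntegral.
Variable R : realType.
Notation lambda := (@lebesgue_measure R).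
Implicit Types (E J : set (R * R)) (t : R).

Definition circ_dist E t : R := inf [set cabs (cis t - toC w) | w in E].

Lemma circ_dist_le E t w : E w -> circ_dist E t <= cabs (cis t - toC w).
Proof.
move=> Ew; apply: ge_inf; last by exists w.
by exists 0 => _ [v _ <-]; exact: cabs_ge0.
Qed.

Lemma le_circ_dist E t x : E !=set0 ->
  (forall w, E w -> x <= cabs (cis t - toC w)) -> x <= circ_dist E t.
Proof.
move=> [w Ew] h; apply: lb_le_inf; first by eexists; exists w.
by move=> _ [v Ev <-]; exact: h.
Qed.

Lemma continuous_circ_dist E : E !=set0 -> continuous (circ_dist E).
Proof.
move=> E0.
have lip s t : circ_dist E s <= circ_dist E t + cabs (cis s - cis t).
  rewrite -lerBlDr; apply: le_circ_dist => // w Ew; rewrite lerBlDr addrC.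
  by apply: (le_trans (circ_dist_le _ Ew)); exact: cabs_triangle.
move=> t; apply/cvgrPdist_le => e e0.
have /cvgrPdist_le /(_ e e0) : cabs (cis s - cis t) @[s --> t] --> cabs (cis t - cis t).
  exact: continuous_chord.
apply: filterS => s; rewrite subrr cabs0 sub0r normrN.
rewrite ger0_norm ?cabs_ge0 // => h.
rewrite ler_norml; have := lip s t; have := lip t s; rewrite (cabsC (cis t)).
lra.
Qed.

Definition arc_angles J : set R := [set t | 0 <= t < 2 * pi /\ J (circ t)].

Lemma arc_angles_sub J : arc_angles J `<=` `[0, pi *+ 2].
Proof. by move=> t [ht _]; rewrite /= in_itv /= -mulr_natr; lra. Qed.

Lemma measurable_arc_angles E : closed E -> measurable (arc_angles E).
Proof.
move=> cE; rewrite (_ : arc_angles E = `[0, 2 * pi[ `&` (@circ R) @^-1` E); last first.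
  by apply/seteqP; split => t; rewrite /= in_itv.
apply: measurableI => //; apply: closed_measurable; apply: closed_comp => //.
by move=> x _; exact: continuous_circ.
Qed.

(** What the summation over the arcs uses: a rational angle, which makes the arcs
    countable, and two points a, b such that the distance to E is at least the
    distance to a or to b. *)
Lemma complementary_arc_data E J : closed E -> E `<=` @unit_circle R -> E !=set0 ->
  complementary_arcs E J ->
  [/\ measurable (arc_angles J),
      exists q : rat, arc_angles J (ratr q) &
      exists a b : R[i], forall t, arc_angles J t ->
        0 < Num.min (cabs (cis t - a)) (cabs (cis t - b)) <= circ_dist E t].
Proof.
move=> cE Ec E0 [w [cw nEw] JE].
have pi0 := pi_gt0 R.
have [t0 ht0 wE] : exists2 t0, 0 <= t0 < 2 * pi & w = circ t0.
  have [u hu ->] := circ_angle pi cw.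
  have [h|h] := ltP u pi; first by exists (pi + u) => //; lra.
  exists 0; first lra.
  have -> : pi + u = 0 + pi *+ 2 by rewrite -mulr_natr; lra.
  by rewrite /circ cosD2pi sinD2pi.
rewrite wE in nEw JE cw; clear wE w.
have [m [L [hL Em Ep t0L nE]]] := complementary_gap cE Ec E0 nEw.
have {}JE : J = [set w | unit_circle w /\ cos L < chord_height m w].
  by rewrite -JE; exact: component_chord_height.
have angE : arc_angles J = `[0, 2 * pi[ `&` [set t | cos L < cos (t - m)].
  apply/seteqP; split => t; rewrite /arc_angles JE /= in_itv /=.
    by rewrite chord_height_circ => -[? []].
  by rewrite chord_height_circ => -[? ?]; do !split => //; exact: unit_circle_circ.
split.
- rewrite angE; apply: measurableI => //; apply: measurable_set_ltr => //.
  apply: continuous_measurable_fun => t.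
  apply: (@continuous_comp _ _ _ (fun t => t - m) cos).
    by apply: cvgB; [exact: cvg_id|exact: cvg_cst].
  exact: continuous_cos.
- have [|q] := @rat_in_itvoo R (Num.max 0 (m - L)) (Num.min (2 * pi) (m + L)).
    rewrite gt_max !lt_min; move: t0L; rewrite ltr_distl; lra.
  rewrite in_itv /= gt_max lt_min => hq; exists q.
  rewrite angE /= in_itv /=; split; first lra.
  rewrite cos_gt_abs ?ltr_distl ?ler_distl; lra.
- exists (cis (m - L)), (cis (m + L)) => t [ht]; rewrite JE => -[ct Jt].
  have pos e : E (circ e) -> 0 < cabs (cis t - cis e).
    move=> Ee; rewrite cabs_gt0 subr_eq0; apply/eqP => te.
    have /(circ_angle m)[u hu tE] := ct.
    move: Jt; rewrite tE chord_height_circ addrAC subrr add0r.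
    rewrite cos_gt_abs; [|rewrite ler_norml; lra|lra].
    move=> /nE; rewrite -tE; apply.
    by move: te => [c s]; rewrite /circ c s.
  apply/andP; split; first by rewrite lt_min !pos.
  apply: le_circ_dist => // v Ev.
  exact: (chord_ge_gap_ends Ec hL nE ct Jt Ev).
Qed.

Lemma complementary_arcs_disjoint E J J' w : complementary_arcs E J ->
  complementary_arcs E J' -> J w -> J' w -> J = J'.
Proof.
move=> [x _ <-] [y _ <-] Jw J'w.
by rewrite (same_connected_component Jw) (same_connected_component J'w).
Qed.

Lemma circ_complementary_arc E t : ~ E (circ t) ->
  exists2 J, complementary_arcs E J & J (circ t).
Proof.
move=> nE; have ct : (@unit_circle R `\` E) (circ t).
  by split => //; exact: unit_circle_circ.
by exists (connected_component (@unit_circle R `\` E) (circ t));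
  [exists (circ t)|exact: connected_component_refl].
Qed.

Local Open Scope ereal_scope.

(** On a complementary arc J the integrand is at most the sum of two powers of
    chords, so it contributes O(|J|^(1-p)); summing over J gives the series of the
    Beurling-Carleson condition, and E itself is null. *)
Theorem integral_circ_dist_lty E p : (0 < p < 1)%R -> beurling_carleson (1 - p)%R E ->
  E !=set0 ->
  \int[lambda]_(t in `[0%R, (2 * pi)%R[) (circ_dist E t `^ (- p))%R%:E < +oo.
Proof.
move=> hp [Ec cE lE sE] E0; have /andP[p0 p1] := hp.
pose f t : \bar R := ((circ_dist E t `^ (- p))%R)%:E.
have f0 t : 0 <= f t by rewrite lee_fin powR_ge0.
have mf D : measurable_fun D f.
  apply: (measurable_funS _ (subsetT D)) => //; apply/measurable_EFinP.
  apply: (measurableT_comp (measurable_powR _)).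
  by apply: continuous_measurable_fun; exact: continuous_circ_dist.
have [C C0 hC] := integral_chord_powRN hp.
have data J : complementary_arcs E J -> _ := complementary_arc_data cE Ec E0.
have /choice[h hP] : forall J, exists n, complementary_arcs E J ->
    exists2 q : rat, arc_angles J (ratr q) & n = pickle q.
  move=> J; have [/data[_ [q Jq] _]|nJ] := pselect (complementary_arcs E J).
    by exists (pickle q) => _; exists q.
  by exists 0%N.
have h_inj : set_inj (complementary_arcs E) h.
  move=> J J' /set_mem cJ /set_mem cJ' hh.
  have [q [_ Jq] hq] := hP _ cJ; have [q' [_ Jq'] hq'] := hP _ cJ'.
  apply: (complementary_arcs_disjoint cJ cJ' Jq).
  by move: hh; rewrite hq hq' => /(pcan_inj pickleK) ->.
(* The arcs, numbered by their rational angle; F n is empty for the other n. *)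
pose F n := [set t | exists J, [/\ complementary_arcs E J, h J = n & arc_angles J t]].
have FE J : complementary_arcs E J -> F (h J) = arc_angles J.
  move=> cJ; apply/seteqP; split => t; last by move=> Jt; exists J.
  by move=> [J' [cJ' hJ' J't]]; rewrite (h_inj J J') ?inE.
have F0 n : ~ (h @` complementary_arcs E) n -> F n = set0.
  move=> nh; apply/seteqP; split => t // [J [cJ hJ _]].
  by apply: nh; exists J.
have mF n : measurable (F n).
  have [[J cJ <-]|/F0 ->//] := pselect ((h @` complementary_arcs E) n).
  by rewrite FE //; have [] := data _ cJ.
have tF : trivIset setT F.
  move=> n n' _ _ [t [[J [cJ <- [_ Jt]]] [J' [cJ' <- [_ J't]]]]].
  by rewrite (complementary_arcs_disjoint cJ cJ' Jt J't).
pose N := arc_angles E.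
have mN : measurable N by exact: measurable_arc_angles.
have cover : `[0%R, (2 * pi)%R[ `\` N = \bigcup_n F n.
  apply/seteqP; split => t.
    move=> [/= + nN]; rewrite in_itv /= => ht.
    have [|J cJ Jt] := @circ_complementary_arc E t; first by move=> Et; apply: nN.
    by exists (h J) => //; exists J.
  move=> [n _ [J [cJ _ [ht Jt]]]]; split; first by rewrite /= in_itv.
  case=> _; move: cJ Jt => [w _ <-] /connected_component_sub [_]; exact.
change (\int[lambda]_(t in `[0%R, (2 * pi)%R[) f t < +oo).
have -> : \int[lambda]_(t in `[0%R, (2 * pi)%R[) f t =
    \int[lambda]_(t in `[0%R, (2 * pi)%R[ `\` N) f t.
  by apply: ge0_negligible_integral => //; exact: mf.
rewrite cover ge0_integral_bigcup //; last by exact: mf.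
pose a n : \bar R := lambda (F n) `^ (1 - p).
have a0 n : 0 <= a n by exact: poweR_ge0.
apply: (@le_lt_trans _ _ (\sum_(n <oo) ((2 * C)%:E * a n))).
  apply: lee_nneseries => n _; first by move=> *; exact: integral_ge0.
  have [[J cJ <-]|/F0 ->] := pselect ((h @` complementary_arcs E) n); last first.
    by rewrite integral_set0 mule_ge0 // lee_fin mulr_ge0.
  have [mJ _ [z [w hzw]]] := data _ cJ; rewrite /a FE //.
  apply: (@le_trans _ _ (\int[lambda]_(t in arc_angles J)
     ((cabs (cis t - z) `^ (- p))%R%:E + (cabs (cis t - w) `^ (- p))%R%:E))).
    apply: le_integral_pointwise => t Jt; first exact: f0.
    have /andP[m0 mE] := hzw _ Jt.
    rewrite -EFinD lee_fin; apply: (le_trans (powRN_anti (ltW p0) m0 mE)).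
    by rewrite minEle; case: ifP => _; rewrite ?lerDl ?lerDr powR_ge0.
  have mc c : measurable_fun (arc_angles J) (fun t => (cabs (cis t - c) `^ (- p))%R%:E).
    apply/measurable_EFinP; apply: (measurableT_comp (measurable_powR _)).
    exact: measurable_chord.
  rewrite ge0_integralD //; try (by move=> *; rewrite lee_fin powR_ge0); try exact: mc.
  rewrite mulrDl mul1r EFinD ge0_muleDl ?lee_fin //.
  by apply: leeD; apply: hC => //; exact: arc_angles_sub.
rewrite nneseriesZl // nneseries_esumT //.
have -> : \esum_(n in [set: nat]) a n = \esum_(n in h @` complementary_arcs E) a n.
  rewrite [RHS]esum_mkcond; apply: eq_esum => n _.
  case: ifPn => // /negP; rewrite inE => /F0 Fn.
  by rewrite /a Fn measure0 poweR0r //; lra.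
rewrite esum_image //.
have -> : \esum_(J in complementary_arcs E) a (h J) =
    \esum_(J in complementary_arcs E) arc_length J `^ (1 - p).
  by apply: eq_esum => J cJ; rewrite /a FE.
by rewrite lte_mul_pinfty // ?lee_fin ?mulr_ge0.
Qed.

End DistanceIntegral.

(** * Averages over squares near the circle *)

Section PlaneMeasure.
Variable R : realType.
Notation lambda := (@lebesgue_measure R).
Local Open Scope ereal_scope.

(** A named copy of the area measure, to carry the sigma-finite structure that
    Tonelli's theorem uses. *)
Definition plane_measure : set (measurableTypeR R * measurableTypeR R) -> \bar R :=
  lambda \x lambda.

HB.instance Definition _ := Measure.on plane_measure.

Lemma plane_measure_sigma_finite : sigma_finite setT plane_measure.
Proof.
have /sigma_finiteP[F [FT Fnd Foo]] := sigma_finiteT lambda.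
exists (fun n => F n `*` F n).
  rewrite -setXTT FT; apply/seteqP; split => [[x y] [/= [n _ Fnx] [k _ Fky]]|].
    exists (maxn n k) => //; split.
    - by move: x Fnx; exact/subsetPset/Fnd/leq_maxl.
    - by move: y Fky; exact/subsetPset/Fnd/leq_maxr.
  by move=> [x y] [n _ []/= ? ?]; split; exists n.
move=> k; have [? ?] := Foo k; split; first exact: measurableX.
have -> : plane_measure (F k `*` F k) = lambda (F k) * lambda (F k).
  exact: product_measure1E.
by rewrite lte_mul_pinfty // ge0_fin_numE.
Qed.

HB.instance Definition _ := Measure_isSigmaFinite.Build _ _ _ plane_measure
  plane_measure_sigma_finite.

End PlaneMeasure.

Section Boxes.
Variable R : realType.
Notation lambda := (@lebesgue_measure R).
Notation lambda2 := (@plane_measure R).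
Notation dyad := (dyad R).
Implicit Types (A : set (R * R)) (t p : R) (n : nat) (w : R * R).

Lemma measurable_cabs_toC : measurable_fun setT (fun w : R * R => cabs (toC w)).
Proof.
apply: (measurableT_comp (continuous_measurable_fun (@sqrt_continuous R))).
by apply: measurable_funD; apply: measurable_funX.
Qed.

(** The centre has modulus 1 - 2^-n and angle t; the half side 2^-n / 8 is small
    enough for the squares of different generations to lie in disjoint annuli. *)
Definition box n t : set (R * R) :=
  [set w | `|w.1 - (1 - dyad n) * cos t| < dyad n / 8 /\
           `|w.2 - (1 - dyad n) * sin t| < dyad n / 8].

Lemma box_near n t w : box n t w ->
  cabs (toC w - ((1 - dyad n)%:C)%C * cis t) <= dyad n / 4.
Proof.
case: w => a b [/=]; have h0 := dyad_gt0 R n.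
rewrite -ler_sqr ?nnegrE ?cabs_ge0 //; last lra.
rewrite cabs2 /= !mul0r subr0 addr0 => hx hy.
have sq x : `|x| < dyad n / 8 -> x ^+ 2 <= (dyad n / 8) ^+ 2.
  by move=> hx'; rewrite -real_normK ?num_real // ler_pXn2r ?nnegrE //; lra.
have := sq _ hx; have := sq _ hy; nra.
Qed.

Lemma cabs_ray t (x : R) : 0 <= x -> cabs ((x%:C)%C * cis t) = x.
Proof. by move=> x0; rewrite cabsM cabs_real cabs_cis mulr1 ger0_norm. Qed.

Lemma box_annulus n t w : box n t w ->
  3 / 4 * dyad n <= 1 - cabs (toC w) <= 5 / 4 * dyad n.
Proof.
move=> /box_near; set z := (_ * cis t)%R => h.
have zE : cabs z = 1 - dyad n.
  by rewrite cabs_ray // subr_ge0 dyad_le1.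
have := cabsD (toC w - z) z; have := cabsD (z - toC w) (toC w).
rewrite !subrK (cabsC z) zE; lra.
Qed.

(** For n = 0 the centre is the origin and the bound is the diameter of the circle;
    for n > 0 the centres have modulus at least 1/2. *)
Lemma box_diam n s t w : box n s w -> box n t w ->
  cabs (cis s - cis t) <= 2 * dyad n.
Proof.
move=> /box_near hs /box_near ht.
case: n hs ht => [_ _|n].
  rewrite dyad0 mulr1; apply: (le_trans (cabsD _ _)).
  by rewrite cabsN !cabs_cis; lra.
set h := dyad n.+1 => hs ht.
have h2 : h <= 1 / 2 by rewrite /h dyadS; have := dyad_le1 R n; lra.
have := @cabs_triangle R (toC w) (((1 - h)%:C)%C * cis s) (((1 - h)%:C)%C * cis t).
rewrite -mulrBr cabsM cabs_real ger0_norm ?(cabsC _ (toC w)); last lra.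
have := cabs_ge0 (cis s - cis t); nra.
Qed.

Lemma box_area n t : (lambda2 (box n t) = ((dyad n / 4) ^+ 2)%:E)%E.
Proof.
have h0 := dyad_gt0 R n.
pose I (c : R) : set R := [set` `]c - dyad n / 8, c + dyad n / 8[].
have -> : box n t = I ((1 - dyad n) * cos t) `*` I ((1 - dyad n) * sin t).
  by apply/seteqP; split => w; rewrite /box /I /= !in_itv /= !ltr_distl.
set a := (_ * cos t); set b := (_ * sin t).
transitivity (lambda (I a) * lambda (I b))%E.
  by apply: product_measure1E; exact: measurable_itv.
have IE c : lambda (I c) = (dyad n / 4)%:E.
  rewrite lebesgue_measure_itv /= lte_fin ifT; last lra.
  by rewrite -EFinB; congr EFin; lra.
by rewrite !IE -EFinM expr2.
Qed.

(** The relative area of A in the square: a function of t which dominates the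
    indicator of the inclusion of the square in A and is measurable by Tonelli. *)
Definition box_density A n t : \bar R :=
  (((4 / dyad n) ^+ 2)%:E * lambda2 (A `&` box n t))%E.

Lemma measurable_abscissa_sub (f : R -> R) : continuous f ->
  measurable_fun setT (fun x : R * (R * R) => x.2.1 - f x.1).
Proof.
move=> cf; apply: measurable_funB; first exact: measurableT_comp.
by apply: measurableT_comp => //; exact: continuous_measurable_fun.
Qed.

Lemma measurable_ordinate_sub (f : R -> R) : continuous f ->
  measurable_fun setT (fun x : R * (R * R) => x.2.2 - f x.1).
Proof.
move=> cf; apply: measurable_funB; first exact: measurableT_comp.
by apply: measurableT_comp => //; exact: continuous_measurable_fun.
Qed.

Definition box_graph A n : set (R * (R * R)) :=
  [set x | [/\ 0 <= x.1 <= pi *+ 2, A x.2 & box n x.1 x.2]].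

Lemma measurable_box_graph A n : measurable A -> measurable (box_graph A n).
Proof.
move=> mA.
rewrite (_ : box_graph A n = (fst @^-1` `[0, pi *+ 2]) `&` ((snd @^-1` A) `&`
   ([set x | `|x.2.1 - (1 - dyad n) * cos x.1| < dyad n / 8] `&`
    [set x | `|x.2.2 - (1 - dyad n) * sin x.1| < dyad n / 8]))); last first.
  by apply/seteqP; split => x; rewrite /box_graph /= in_itv /=; [case=> ? ? []|case=> ? [? ?]].
have cc : continuous (fun t : R => (1 - dyad n) * cos t).
  by move=> t; apply: cvgMr; exact: continuous_cos.
have cs : continuous (fun t : R => (1 - dyad n) * sin t).
  by move=> t; apply: cvgMr; exact: continuous_sin.
apply: measurableI.
  by rewrite -[X in measurable X]setTI; exact: measurable_fst.
apply: measurableI.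
  by rewrite -[X in measurable X]setTI; exact: measurable_snd.
apply: measurableI; apply: measurable_set_ltr => //.
  exact: (measurableT_comp (@normr_measurable R setT) (measurable_abscissa_sub cc)).
exact: (measurableT_comp (@normr_measurable R setT) (measurable_ordinate_sub cs)).
Qed.

Lemma box_density_ge0 A n t : (0 <= box_density A n t)%E.
Proof. by rewrite mule_ge0 // lee_fin sqr_ge0. Qed.

Lemma box_density_ge1 A n t : box n t `<=` A -> (1 <= box_density A n t)%E.
Proof.
move=> sub; rewrite /box_density setIidr // box_area -EFinM lee_fin.
rewrite -exprMn (_ : 4 / dyad n * (dyad n / 4) = 1) ?expr1n //.
by field; rewrite gt_eqF ?dyad_gt0.
Qed.

Lemma measurable_box_density A n : measurable A ->
  measurable_fun `[0, pi *+ 2] (box_density A n).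
Proof.
move=> mA; apply: measurable_funeM.
have mB := measurable_box_graph n mA.
apply: (@eq_measurable_fun _ _ _ _ _ (lambda2 \o xsection (box_graph A n))).
  move=> t; rewrite inE /= in_itv /= => ht; congr (lambda2 _).
  by apply/seteqP; split => w; rewrite /xsection /= inE /box_graph /=; [case|case].
apply: measurable_funTS.
exact: (measurable_fun_xsection lambda2 mB).
Qed.

Definition annulus n : set (R * R) :=
  [set w | 3 / 4 * dyad n <= 1 - cabs (toC w) <= 5 / 4 * dyad n].

Lemma measurable_annulus n : measurable (annulus n).
Proof.
have m1 : measurable_fun setT (fun w : R * R => 1 - cabs (toC w)).
  by apply: measurable_funB => //; exact: measurable_cabs_toC.
rewrite (_ : annulus n = [set w | 3 / 4 * dyad n <= 1 - cabs (toC w)] `&`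
    [set w | 1 - cabs (toC w) <= 5 / 4 * dyad n]); last first.
  by apply/seteqP; split => w; [move=> /andP|move=> ?; apply/andP].
by apply: measurableI; exact: measurable_set_ler.
Qed.

(** The ratio 5/3 of the bounds in one annulus is less than the ratio 2 of the scales. *)
Lemma trivIset_annulus : trivIset setT annulus.
Proof.
have lt_annulus m n w : (m < n)%N -> annulus m w -> ~ annulus n w.
  move=> mn /andP[hm _] /andP[_ hn].
  have : dyad n <= dyad m.+1 by rewrite ler_wiXn2l //; lra.
  by rewrite dyadS; have := dyad_gt0 R n; lra.
move=> m n _ _ [w [hm hn]].
by have [/lt_annulus/(_ hm)/(_ hn)|/lt_annulus/(_ hn)/(_ hm)|] := ltngtP m n.
Qed.

(** The factor 2 absorbs (5/4)^(1+p), which is at most (5/4)^2. *)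
Lemma annulus_weight n p w (k : R) : 0 <= k -> 0 < p < 1 -> annulus n w ->
  dyad n `^ (- p) * (k / dyad n) <= 2 * k * ((1 - cabs (toC w)) `^ (1 + p))^-1.
Proof.
move=> k0 hp /andP[]; have h0 := dyad_gt0 R n.
move: (1 - _) => x x1 x2.
have x0 : 0 < x by lra.
have xh : x `^ (1 + p) <= 2 * dyad n `^ (1 + p).
  apply: (@le_trans _ _ ((5 / 4 * dyad n) `^ (1 + p))).
    by apply: ge0_ler_powR; rewrite ?nnegrE; lra.
  rewrite powRM; [|lra|lra]; rewrite ler_wpM2r ?powR_ge0 //.
  apply: (@le_trans _ _ ((5 / 4 : R) `^ 2%:R)); first by apply: ler_powR; lra.
  by rewrite powR_mulrn; lra.
have y0 : 0 < dyad n `^ (1 + p) by exact: powR_gt0.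
have -> : dyad n `^ (- p) * (k / dyad n) = 2 * k * (2 * dyad n `^ (1 + p))^-1.
  rewrite powRN powRD_gt0 // powRr1 ?(ltW h0) //.
  have z0 : 0 < dyad n `^ p by exact: powR_gt0.
  by field; rewrite !gt_eqF.
rewrite ler_wpM2l ?mulr_ge0 // lef_pV2 ?posrE ?powR_gt0 //.
by rewrite mulr_gt0.
Qed.

Local Open Scope ereal_scope.

(** Tonelli: for a fixed point w the angles t whose square contains w lie in an arc
    of length O(2^-n), and w lies in the annulus of that generation. This replaces
    the change to polar coordinates. *)
Lemma integral_box_density A n : measurable A ->
  \int[lambda]_(t in `[0%R, (pi *+ 2)%R]) box_density A n t <=
  (384 / dyad n)%:E * lambda2 (A `&` annulus n).
Proof.
move=> mA; have h0 := dyad_gt0 R n; have mB := measurable_box_graph n mA.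
pose B := box_graph A n.
have mx : measurable_fun setT (lambda2 \o xsection B).
  exact: (measurable_fun_xsection lambda2 mB).
apply: (@le_trans _ _ (\int[lambda]_t (((4 / dyad n) ^+ 2)%:E * (lambda2 \o xsection B) t))).
  apply: (@le_trans _ _ (\int[lambda]_(t in `[0%R, (pi *+ 2)%R])
      (((4 / dyad n) ^+ 2)%:E * (lambda2 \o xsection B) t))); last first.
    apply: ge0_subset_integral => //; first exact: measurable_funeM.
    by move=> t _; rewrite mule_ge0 // lee_fin sqr_ge0.
  apply: le_integral_pointwise => t; first by move=> _; exact: box_density_ge0.
  rewrite /= in_itv /= => ht; rewrite /box_density le_eqVlt; apply/orP; left; apply/eqP.
  congr (_ * lambda2 _).
  by apply/seteqP; split => w; rewrite /xsection /= inE /B /box_graph /=; [case|case].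
rewrite ge0_integralZl //; last by rewrite lee_fin sqr_ge0.
have -> : \int[lambda]_t (lambda2 \o xsection B) t = \int[lambda2]_w (lambda \o ysection B) w.
  rewrite -(indic_fubini_tonelli_FE lambda2 mB) -(indic_fubini_tonelli_GE lambda mB).
  exact: (indic_fubini_tonelli lambda lambda2 mB).
apply: (@le_trans _ _ (((4 / dyad n) ^+ 2)%:E * \int[lambda2]_w
    ((24 * dyad n)%:E * (\1_(A `&` annulus n) w)%:E))).
  apply: lee_pmul => //; rewrite ?lee_fin ?sqr_ge0 //; first exact: integral_ge0.
  apply: le_integral_pointwise => // w _ /=.
  have mY : measurable (ysection B w) by exact: measurable_ysection.
  have [[Aw Tw]|nw] := pselect ((A `&` annulus n) w); last first.
    rewrite (_ : ysection B w = set0) ?measure0 ?mule_ge0 ?lee_fin //; first lra.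
    apply/seteqP; split => t //; rewrite /ysection /= inE /B /box_graph /= => -[_ Aw bw].
    by apply: nw; split => //; exact: box_annulus bw.
  rewrite indicE mem_set // mule1 (_ : (24 * dyad n = 12 * (2 * dyad n))%R); last lra.
  apply: measure_angles_le_diam => //; first lra.
    by move=> t; rewrite /ysection /= inE /B /box_graph /= in_itv /= => -[].
  move=> s t; rewrite /ysection /= !inE /B /box_graph /= => -[_ _ bs] [_ _ bt].
  exact: box_diam bs bt.
have mAa : measurable (A `&` annulus n) by apply: measurableI => //; exact: measurable_annulus.
rewrite ge0_integralZl //; last 2 first.
- by apply/measurable_EFinP; exact: measurable_indic.
- by rewrite lee_fin; lra.
rewrite integral_indic // setIT muleA -EFinM le_eqVlt; apply/orP; left; apply/eqP.
by congr (_ * _); congr EFin; field; rewrite gt_eqF.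
Qed.

(** The weight 2^(np) times the inverse area 4^n times the angle 2^-n is comparable
    with (1 - |w|)^-(1+p) on the n-th annulus, and the annuli are disjoint. *)
Lemma integral_sum_box_density A p : (0 < p < 1)%R -> measurable A ->
  \int[lambda2]_(w in A) (((1 - cabs (toC w)) `^ (1 + p))^-1)%R%:E < +oo ->
  \int[lambda]_(t in `[0%R, (pi *+ 2)%R])
    (\sum_(n <oo) ((dyad n `^ (- p))%:E * box_density A n t)) < +oo.
Proof.
move=> /andP[p0 p1] mA Afin.
have [K K0 hK] : exists2 K : R, (0 <= K)%R & forall n,
    \int[lambda]_(t in `[0%R, (pi *+ 2)%R]) box_density A n t <=
    (K / dyad n)%:E * lambda2 (A `&` annulus n).
  by exists 384%R => [|n]; [exact: ler0n|exact: integral_box_density].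
pose phi w : \bar R := (((1 - cabs (toC w)) `^ (1 + p))^-1)%R%:E.
have phi0 w : 0 <= phi w by rewrite lee_fin invr_ge0 powR_ge0.
have mphi D : measurable_fun D phi.
  apply: (measurable_funS _ (subsetT D)) => //; apply/measurable_EFinP.
  rewrite (_ : (fun w => _) = (fun w : R * R => (1 - cabs (toC w)) `^ (- (1 + p)))%R); last first.
    by apply/funext => w; rewrite powRN.
  apply: (measurableT_comp (measurable_powR _)).
  by apply: measurable_funB => //; exact: measurable_cabs_toC.
have mAn n : measurable (A `&` annulus n).
  by apply: measurableI => //; exact: measurable_annulus.
have dp n : (0 <= dyad n `^ (- p))%R by exact: powR_ge0.
rewrite integral_nneseries //; last 2 first.
- by move=> n; apply: measurable_funeM; exact: measurable_box_density.
- by move=> n t _; rewrite mule_ge0 ?lee_fin // box_density_ge0.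
apply: (@le_lt_trans _ _ (\sum_(n <oo) ((2 * K)%:E * \int[lambda2]_(w in A `&` annulus n) phi w))).
  apply: lee_nneseries => n _.
    by move=> _; apply: integral_ge0 => t _; rewrite mule_ge0 ?lee_fin // box_density_ge0.
  have h0 := dyad_gt0 R n.
  rewrite ge0_integralZl //; last 3 first.
  - exact: measurable_box_density.
  - by move=> t _; exact: box_density_ge0.
  - by rewrite lee_fin.
  apply: (@le_trans _ _ ((dyad n `^ (- p))%:E * ((K / dyad n)%:E * lambda2 (A `&` annulus n)))).
    by apply: lee_wpmul2l; [rewrite lee_fin|exact: hK].
  rewrite muleA -EFinM.
  have <- : \int[lambda2]_(w in A `&` annulus n) ((2 * K)%:E * phi w) =
      (2 * K)%:E * \int[lambda2]_(w in A `&` annulus n) phi w.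
    apply: ge0_integralZl; [exact: mAn|exact: mphi|by []|by rewrite lee_fin mulr_ge0].
  have <- : \int[lambda2]_(w in A `&` annulus n) (cst (dyad n `^ (- p) * (K / dyad n))%:E w) =
      (dyad n `^ (- p) * (K / dyad n))%:E * lambda2 (A `&` annulus n).
    by apply: integral_cst; exact: mAn.
  apply: le_integral_pointwise => w [_ wn]; first by rewrite lee_fin mulr_ge0 // divr_ge0 // ltW.
  by rewrite -EFinM lee_fin; apply: annulus_weight; rewrite ?p0.
rewrite nneseriesZl; last by move=> n _; exact: integral_ge0.
rewrite lte_mul_pinfty ?lee_fin ?mulr_ge0 //.
have <- : \int[lambda2]_(w in \bigcup_n (A `&` annulus n)) phi w =
    \sum_(n <oo) \int[lambda2]_(w in A `&` annulus n) phi w.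
  apply: ge0_integral_bigcup; [exact: mAn|exact: mphi|by []|].
  by move=> m n _ _ [w [[_ wm] [_ wn]]]; apply: trivIset_annulus => //; exists w.
apply: le_lt_trans Afin.
apply: ge0_subset_integral; [|exact: mA|exact: mphi|by []|by move=> w [n _ []]].
by apply: bigcup_measurable => n _; exact: mAn.
Qed.

End Boxes.

(** * Complex derivatives from quadratic expansions *)

Lemma is_derive_quadratic (K : numFieldType) (f : K -> K) (z d M e : K) :
  0 <= M -> 0 < e ->
  (forall h, `|h| < e -> `|f (z + h) - f z - d * h| <= M * `|h| ^+ 2) ->
  is_derive (z : K^o) (1 : K^o) (f : K^o -> K^o) (d : K^o).
Proof.
move=> M0 e0 H.
have lim : (fun h : K => h^-1 *: ((f (h *: (1 : K^o) + z) : K^o) - f z)) @ 0^' --> (d : K^o).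
  apply/cvgrPdist_le => eps eps0.
  have M1 : 0 < M + 1 by rewrite ltr_wpDl.
  near=> h.
  have h0 : h != 0 by near: h; exact: nbhs_dnbhs_neq.
  have he : `|h| < e by near: h; exact: dnbhs0_lt.
  have hM : `|h| < eps / (M + 1) by near: h; apply: dnbhs0_lt; rewrite divr_gt0.
  have hn : 0 < `|h| by rewrite normr_gt0.
  have -> : d - h^-1 *: ((f (h *: (1 : K^o) + z) : K^o) - f z) =
      - (h^-1 * (f (z + h) - f z - d * h)).
    have -> : h *: (1 : K^o) = h by exact: mulr1.
    rewrite (addrC h) -[_ *: _]/(h^-1 * (f (z + h) - f z)).
    by field.
  rewrite normrN normrM normfV mulrC ler_pdivrMr //.
  apply: (le_trans (H _ he)).
  rewrite expr2 mulrA ler_pM2r //.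
  apply: (@le_trans _ _ (M * (eps / (M + 1)))); first by rewrite ler_wpM2l // ltW.
  rewrite mulrCA ler_piMr ?(ltW eps0) // ler_pdivrMr // mul1r lerDl //.
split; first by apply/cvg_ex; exists d.
exact: cvg_lim lim.
Unshelve. all: by end_near. Qed.

Section QuadraticExpansion.
Variable R : realType.
Notation C := R[i].
Implicit Types (f g : C -> C) (z w h d : C).

(** Differentiability with an O(h^2) remainder. It is as easy to check as a bound
    between integrands, and it is stable under products and composition. *)
Definition expands f z d := exists K e : R, [/\ 0 <= K, 0 < e &
  forall h, cabs h < e -> cabs (f (z + h) - f z - d * h) <= K * cabs h ^+ 2].

Lemma expands_is_derive f z d : expands f z d ->
  is_derive (z : C^o) (1 : C^o) (f : C^o -> C^o) (d : C^o).
Proof.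
move=> [K [e [K0 e0 H]]].
apply: (@is_derive_quadratic C f z d (K%:C)%C (e%:C)%C); rewrite ?lecR ?ltcR //.
move=> h; rewrite !cabsE ltcR => he.
by rewrite -rmorphXn -rmorphM lecR; exact: H.
Qed.

Lemma expands_derivable f z d : expands f z d ->
  derivable (f : C^o -> C^o) z 1.
Proof. by move=> /expands_is_derive []. Qed.

Lemma expands_cderiv f z d : expands f z d -> cderiv f z = d.
Proof. by move=> /expands_is_derive fd; rewrite /cderiv derive1E; exact: derive_val. Qed.

Lemma expands_near f g z d (e : R) : 0 < e ->
  (forall h, cabs h < e -> f (z + h) = g (z + h)) -> expands f z d -> expands g z d.
Proof.
move=> e0 fg [K [e' [K0 e'0 H]]]; exists K, (Num.min e e'); split => //.
  by rewrite lt_min e0.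
move=> h; rewrite lt_min => /andP[he he']; rewrite -fg // -[in g z](addr0 z) -fg ?addr0 ?cabs0 //.
exact: H.
Qed.

Lemma expands_lip f z d : expands f z d -> exists K e : R, [/\ 0 <= K, 0 < e &
  forall h, cabs h < e -> cabs (f (z + h) - f z) <= K * cabs h].
Proof.
move=> [K [e [K0 e0 H]]]; exists (K + cabs d), (Num.min e 1).
rewrite addr_ge0 ?cabs_ge0 // lt_min e0 ltr01; split => // h.
rewrite lt_min => /andP[he h1].
rewrite -[f _ - f z](subrK (d * h)); apply: (le_trans (cabsD _ _)).
rewrite cabsM mulrDl lerD2r; apply: (le_trans (H _ he)).
by rewrite ler_wpM2l // expr2 ler_piMr ?cabs_ge0 // ltW.
Qed.

Lemma expandsM f g z d d' : expands f z d -> expands g z d' ->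
  expands (fun x => f x * g x) z (d * g z + f z * d').
Proof.
move=> Hf Hg; have [Kf [ef [Kf0 ef0 hf]]] := expands_lip Hf.
have [Kg [eg [Kg0 eg0 hg]]] := expands_lip Hg.
move: Hf Hg => [K [e [K0 e0 H]]] [K' [e' [K'0 e'0 H']]].
exists (Kf * Kg + K * cabs (g z) + cabs (f z) * K'), (Num.min (Num.min ef eg) (Num.min e e')).
rewrite !lt_min ef0 eg0 e0 e'0 !addr_ge0 ?mulr_ge0 ?cabs_ge0 //; split => // h.
rewrite !lt_min => /andP[/andP[hef heg] /andP[he he']].
rewrite (_ : _ - _ - _ = (f (z + h) - f z) * (g (z + h) - g z)
  + (f (z + h) - f z - d * h) * g z + f z * (g (z + h) - g z - d' * h)); last by ring.
apply: (le_trans (cabsD _ _)); rewrite [leRHS]mulrDl lerD //; last first.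
  by rewrite cabsM -mulrA ler_wpM2l ?cabs_ge0 // H'.
apply: (le_trans (cabsD _ _)); rewrite [leRHS]mulrDl lerD //; last first.
  by rewrite cabsM mulrAC ler_wpM2r ?cabs_ge0 // H.
rewrite cabsM expr2 mulrACA; apply: ler_pM; rewrite ?cabs_ge0 //; [exact: hf|exact: hg].
Qed.

Lemma expands_comp f g z d d' : expands g z d -> expands f (g z) d' ->
  expands (f \o g) z (d' * d).
Proof.
move=> Hg; have [Kg [eg [Kg0 eg0 hg]]] := expands_lip Hg.
move: Hg => [K [e [K0 e0 H]]] [K' [e' [K'0 e'0 H']]].
exists (K' * Kg ^+ 2 + cabs d' * K), (Num.min (Num.min eg e) (e' / (Kg + 1))).
have Kg1 : 0 < Kg + 1 by rewrite ltr_wpDl.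
rewrite !lt_min eg0 e0 divr_gt0 // addr_ge0 ?mulr_ge0 ?cabs_ge0 ?sqr_ge0 //; split => // h.
rewrite !lt_min => /andP[/andP[heg he]]; rewrite ltr_pdivlMr // => he'.
pose k := g (z + h) - g z.
have kh : cabs k <= Kg * cabs h by exact: hg.
have ke : cabs k < e'.
  by apply: le_lt_trans he'; apply: (le_trans kh); rewrite mulrC ler_wpM2l ?cabs_ge0 // lerDl.
rewrite /= (_ : _ - _ - _ =
    (f (g z + k) - f (g z) - d' * k) + d' * (g (z + h) - g z - d * h)); last first.
  by rewrite /k subrKC; ring.
apply: (le_trans (cabsD _ _)); rewrite [leRHS]mulrDl lerD //; last first.
  by rewrite cabsM -mulrA ler_wpM2l ?cabs_ge0 // H.
apply: (le_trans (H' _ ke)); rewrite -mulrA ler_wpM2l // -exprMn.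
by rewrite ler_pXn2r // nnegrE ?mulr_ge0 ?cabs_ge0.
Qed.

Lemma expandsN f z d : expands f z d -> expands (fun x => - f x) z (- d).
Proof.
move=> [K [e [K0 e0 H]]]; exists K, e; split => // h he.
by rewrite (_ : _ - _ - _ = - (f (z + h) - f z - d * h)) ?cabsN ?H //; ring.
Qed.

End QuadraticExpansion.

(** * The complex exponential *)

Section Cexp.
Variable R : realType.
Notation C := R[i].
Implicit Types (z w h : C) (x y : R).

Lemma cabs_le_ReIm z : cabs z <= `|complex.Re z| + `|complex.Im z|.
Proof.
rewrite -ler_sqr ?nnegrE ?cabs_ge0 ?addr_ge0 // cabs2 sqrrD !real_normK ?num_real //.
by rewrite lerD2r lerDl mulrn_wge0 // mulr_ge0.
Qed.

Lemma Re_le_cabs z : `|complex.Re z| <= cabs z.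
Proof.
by rewrite -ler_sqr ?nnegrE ?cabs_ge0 // cabs2 real_normK ?num_real // lerDl sqr_ge0.
Qed.

Lemma Im_le_cabs z : `|complex.Im z| <= cabs z.
Proof.
by rewrite -ler_sqr ?nnegrE ?cabs_ge0 // cabs2 real_normK ?num_real // lerDr sqr_ge0.
Qed.

Lemma cexpD z w : cexp (z + w) = cexp z * cexp w.
Proof.
case: z w => [a b] [c d]; rewrite /cexp /= expRD cisD rmorphM /=; ring.
Qed.

Lemma cabs_cexp z : cabs (cexp z) = expR (complex.Re z).
Proof. by rewrite cabsM cabs_cis mulr1 cabs_real ger0_norm // expR_ge0. Qed.

Lemma sin_MVT y : exists2 v, `|v| <= `|y| & sin y = cos v * y.
Proof.
have pos x : 0 <= x -> exists2 v, `|v| <= `|x| & sin x = cos v * x.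
  move=> x0; have [|v] := @MVT_segment R sin cos 0 x x0 (fun y _ => is_derive_sin y).
    exact: continuous_subspaceT (@continuous_sin R).
  rewrite in_itv /= sin0 !subr0 => /andP[v0 vx] e.
  by exists v => //; rewrite !ger0_norm.
have [/pos//|y0] := leP 0 y.
have [|v hv e] := pos (- y); first lra.
exists v; first by rewrite -(normrN y).
by apply: oppr_inj; rewrite -sinN e mulrN.
Qed.

Lemma norm_sin_le y : `|sin y| <= `|y|.
Proof.
have [v _ ->] := sin_MVT y; rewrite normrM ler_piMl //; exact: cos_max.
Qed.

Lemma norm_1Bcos_le y : `|1 - cos y| <= y ^+ 2 / 2.
Proof.
have -> : 1 - cos y = 2 * sin (y / 2) ^+ 2.
  have yE : y = (y / 2) *+ 2 by rewrite -[RHS]mulr_natr; lra.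
  by rewrite [in LHS]yE cos_mulr2n -[_ ^+ 2 *+ 2]mulr_natr cos2sin2; lra.
rewrite ger0_norm; last by rewrite mulr_ge0 // sqr_ge0.
have : `|sin (y / 2)| ^+ 2 <= `|y / 2| ^+ 2 by rewrite ler_sqr ?nnegrE // norm_sin_le.
by rewrite !real_normK ?num_real //; lra.
Qed.

Lemma norm_sinB_le y : `|y| <= 1 -> `|sin y - y| <= y ^+ 2 / 2.
Proof.
move=> y1; have [v vy ->] := sin_MVT y.
rewrite -[X in _ - X]mul1r -mulrBl normrM -normrN opprB.
have h := norm_1Bcos_le v.
have v2 : v ^+ 2 <= y ^+ 2.
  by rewrite -[v ^+ 2]real_normK ?num_real // -[y ^+ 2]real_normK ?num_real // ler_sqr ?nnegrE.
have y2 : 0 <= y ^+ 2 by exact: sqr_ge0.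
have := normr_ge0 y; have := normr_ge0 (1 - cos v); nra.
Qed.

Lemma norm_expR_sub x : `|x| <= 1 / 2 -> `|expR x - 1 - x| <= 2 * x ^+ 2.
Proof.
rewrite ler_norml => hx; have l := expR_ge1Dx x.
have u : expR x * (1 - x) <= 1.
  have := expR_ge1Dx (- x); rewrite expRN => h.
  have p := expR_gt0 x; apply: (@le_trans _ _ (expR x * (expR x)^-1)).
    by rewrite ler_wpM2l ?(ltW p).
  by rewrite mulfV // gt_eqF.
rewrite ger0_norm; last lra.
have : expR x - 1 - x <= x * (expR x - 1) by lra.
nra.
Qed.

Lemma cexp_expands0 h : cabs h < 1 / 2 -> cabs (cexp h - 1 - h) <= 5 * cabs h ^+ 2.
Proof.
move=> h1; have hx := le_lt_trans (Re_le_cabs h) h1; have hy := le_lt_trans (Im_le_cabs h) h1.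
apply: (le_trans (cabs_le_ReIm _)).
rewrite cabs2; case: h h1 hx hy => x y /= _ hx hy; rewrite !mul0r !subr0 !addr0.
have -> : expR x * cos y - 1 - x = (expR x - 1 - x) * cos y - (1 + x) * (1 - cos y) by ring.
have -> : expR x * sin y - y = (expR x - 1 - x) * sin y + x * sin y + (sin y - y) by ring.
have e2 : `|expR x - 1 - x| <= 2 * x ^+ 2 by apply: norm_expR_sub; exact: ltW.
have c1 : `|cos y| <= 1 := cos_max y.
have c2 := norm_1Bcos_le y; have s1 := norm_sin_le y; have s2 : `|sin y| <= 1 := sin_max y.
have s3 : `|sin y - y| <= y ^+ 2 / 2 by apply: norm_sinB_le; lra.
have x1 : `|1 + x| <= 3 / 2 by rewrite ler_norml; move: hx; rewrite ltr_norml; lra.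
have re : `|(expR x - 1 - x) * cos y - (1 + x) * (1 - cos y)| <= 2 * x ^+ 2 + 3 / 4 * y ^+ 2.
  apply: (le_trans (ler_normB _ _)); rewrite !normrM lerD //.
    rewrite -[leRHS]mulr1; exact: ler_pM.
  rewrite (_ : 3 / 4 * y ^+ 2 = 3 / 2 * (y ^+ 2 / 2)); last lra.
  exact: ler_pM.
have xy : `|x| * `|y| <= x ^+ 2 / 2 + y ^+ 2 / 2.
  rewrite -[x ^+ 2]real_normK ?num_real // -[y ^+ 2]real_normK ?num_real //.
  by have := sqr_ge0 (`|x| - `|y|); rewrite sqrrB; lra.
have im : `|(expR x - 1 - x) * sin y + x * sin y + (sin y - y)| <=
    2 * x ^+ 2 + (x ^+ 2 / 2 + y ^+ 2 / 2) + y ^+ 2 / 2.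
  apply: (le_trans (ler_normD _ _)); rewrite lerD //.
  apply: (le_trans (ler_normD _ _)); rewrite !normrM lerD //.
    by rewrite -[leRHS]mulr1; exact: ler_pM.
  by apply: le_trans xy; rewrite ler_wpM2l.
by have := sqr_ge0 x; have := sqr_ge0 y; lra.
Qed.

Lemma cexp_expands z : expands (@cexp R) z (cexp z).
Proof.
exists (cabs (cexp z) * 5), (1 / 2); split; [by rewrite mulr_ge0 ?cabs_ge0|lra|] => h h1.
rewrite cexpD (_ : _ - _ - _ = cexp z * (cexp h - 1 - h)); last by ring.
by rewrite cabsM -mulrA ler_wpM2l ?cabs_ge0 // cexp_expands0.
Qed.

End Cexp.

(** * Measurability of complex functions and of plane sets *)

Section ComplexMeasurable.
Context d (T : measurableType d) (R : realType).
Notation C := R[i].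
Implicit Types (f g : T -> C) (c : C).

Definition cmeasurable f :=
  measurable_fun setT (fun w => complex.Re (f w)) /\
  measurable_fun setT (fun w => complex.Im (f w)).

Lemma cmeasurable_toC (g : T -> R * R) : measurable_fun setT g ->
  cmeasurable (fun x => toC (g x)).
Proof. by move=> mg; split; exact: measurableT_comp. Qed.

Lemma cmeasurable_cst c : cmeasurable (fun=> c).
Proof. by split; exact: measurable_cst. Qed.

Lemma Re_add (z w : C) : complex.Re (z + w) = complex.Re z + complex.Re w.
Proof. by case: z w => [? ?] [? ?]. Qed.

Lemma Im_add (z w : C) : complex.Im (z + w) = complex.Im z + complex.Im w.
Proof. by case: z w => [? ?] [? ?]. Qed.

Lemma Re_opp (z : C) : complex.Re (- z) = - complex.Re z.
Proof. by case: z. Qed.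

Lemma Im_opp (z : C) : complex.Im (- z) = - complex.Im z.
Proof. by case: z. Qed.

Lemma Re_mul (z w : C) : complex.Re (z * w) =
  complex.Re z * complex.Re w - complex.Im z * complex.Im w.
Proof. by case: z w => [? ?] [? ?]. Qed.

Lemma Im_mul (z w : C) : complex.Im (z * w) =
  complex.Re z * complex.Im w + complex.Im z * complex.Re w.
Proof. by case: z w => [? ?] [? ?]. Qed.

Lemma Re_inv (z : C) : complex.Re z^-1 = complex.Re z * (cabs z ^+ 2)^-1.
Proof. by rewrite cabs2; case: z. Qed.

Lemma Im_inv (z : C) : complex.Im z^-1 = - complex.Im z * (cabs z ^+ 2)^-1.
Proof. by rewrite cabs2; case: z => a b /=; rewrite mulNr. Qed.

Lemma cmeasurableD f g : cmeasurable f -> cmeasurable g ->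
  cmeasurable (fun w => f w + g w).
Proof.
move=> [fr fi] [gr gi]; split.
  by under eq_fun do rewrite Re_add; exact: measurable_funD.
by under eq_fun do rewrite Im_add; exact: measurable_funD.
Qed.

Lemma cmeasurableN f : cmeasurable f -> cmeasurable (fun w => - f w).
Proof.
move=> [fr fi]; split.
  by under eq_fun do rewrite Re_opp; exact: measurableT_comp.
by under eq_fun do rewrite Im_opp; exact: measurableT_comp.
Qed.

Lemma cmeasurableM f g : cmeasurable f -> cmeasurable g ->
  cmeasurable (fun w => f w * g w).
Proof.
move=> [fr fi] [gr gi]; split.
  under eq_fun do rewrite Re_mul; apply: measurable_funB; exact: measurable_funM.
under eq_fun do rewrite Im_mul; apply: measurable_funD; exact: measurable_funM.
Qed.

Lemma measurable_cabs f : cmeasurable f -> measurable_fun setT (fun w => cabs (f w)).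
Proof.
move=> [fr fi].
rewrite (_ : (fun w => _) = (fun w => Num.sqrt (complex.Re (f w) ^+ 2 + complex.Im (f w) ^+ 2))).
  apply: (measurableT_comp (continuous_measurable_fun (@sqrt_continuous R))).
  by apply: measurable_funD; apply: measurable_funX.
by apply/funext => w; rewrite -cabs2 sqrtr_sqr ger0_norm ?cabs_ge0.
Qed.

Lemma measurable_invr_ge0 (g : T -> R) : (forall w, 0 <= g w) ->
  measurable_fun setT g -> measurable_fun setT (fun w => (g w)^-1).
Proof.
move=> g0 mg; rewrite (_ : (fun w => _) = (fun w => g w `^ (-1))).
  exact: (measurableT_comp (measurable_powR _) mg).
by apply/funext => w; rewrite powR_inv1.
Qed.

Lemma cmeasurableV f : cmeasurable f -> cmeasurable (fun w => (f w)^-1).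
Proof.
move=> mf; have [fr fi] := mf.
have mV : measurable_fun setT (fun w => (cabs (f w) ^+ 2)^-1).
  apply: measurable_invr_ge0; first by move=> w; exact: sqr_ge0.
  by apply: measurable_funX; exact: measurable_cabs.
split.
  by under eq_fun do rewrite Re_inv; exact: measurable_funM.
under eq_fun do rewrite Im_inv; apply: measurable_funM => //; exact: measurableT_comp.
Qed.

End ComplexMeasurable.

Section PlaneSets.
Variable R : realType.

Lemma measurable_unit_circle : measurable (@unit_circle R).
Proof.
have mc := @measurable_cabs_toC R.
rewrite (_ : @unit_circle R = [set w | cabs (toC w) <= 1] `&` [set w | 1 <= cabs (toC w)]).
  by apply: measurableI; exact: measurable_set_ler.
apply/seteqP; split => w; rewrite /unit_circle /=; first by move=> ->.
by case=> h1 h2; apply/eqP; rewrite eq_le h1.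
Qed.

Lemma measurable_unit_disk : measurable (@unit_disk R).
Proof. by apply: measurable_set_ltr => //; exact: measurable_cabs_toC. Qed.

Lemma open_measurable_plane (U : set (R * R)) : open U -> measurable U.
Proof.
move=> oU.
pose B (q : (rat * rat) * (rat * rat)) : set (R * R) :=
  [set` `]ratr q.1.1, ratr q.1.2[] `*` [set` `]ratr q.2.1, ratr q.2.2[].
rewrite (_ : U = \bigcup_q (if pselect (B q `<=` U) then B q else set0)); last first.
  apply/seteqP; split => [w Uw|w [q _]]; last by case: pselect => // BU; exact: BU.
  have /nbhs_ballP[e /= e0 eU] : nbhs w U by rewrite openE in oU; exact: oU.
  have near (x : R) : exists q : rat * rat,
      [/\ ratr q.1 < x, x < ratr q.2 & forall y, ratr q.1 < y < ratr q.2 -> `|x - y| < e].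
    have [|a] := @rat_in_itvoo R (x - e / 2) x; first by move: e0 => /= ?; lra.
    have [|b] := @rat_in_itvoo R x (x + e / 2); first by move: e0 => /= ?; lra.
    rewrite !in_itv /= => hb ha; exists (a, b) => /=; split; [lra|lra|] => y hy.
    by rewrite ltr_norml; lra.
  have [qa [a1 a2 a3]] := near w.1; have [qb [b1 b2 b3]] := near w.2.
  exists (qa, qb) => //; case: pselect => [BU|nBU]; first by split; rewrite /= in_itv /= ?a1 ?b1.
  case: nBU => v [/=]; rewrite !in_itv /= => v1 v2; apply: eU.
  by split; [exact: a3|exact: b3].
apply: countable_bigcupT_measurable => [|q]; first exact: countableP.
 case: pselect => [BU|nBU] /=; last exact: measurable0.
by apply: measurableX; exact: measurable_itv.
Qed.

Lemma closed_measurable_plane (E : set (R * R)) : closed E -> measurable E.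
Proof.
move=> cE; rewrite -(setCK E); apply: measurableC.
by apply: open_measurable_plane; exact: closed_openC.
Qed.

End PlaneSets.

(** * Complex integrals over the circle *)

Section CircleIntegral.
Variable R : realType.
Notation C := R[i].
Variable mu : {finite_measure set (R * R)%type -> \bar R}.
Implicit Types (f g : R * R -> C) (c : C).
Notation circle := (@unit_circle R).
Notation CI := (@Cintegral R mu circle).

Definition circle_bounded f := cmeasurable f /\
  exists M, forall w, circle w -> cabs (f w) <= M.

Lemma integrable_bounded (g : R * R -> R) M : measurable_fun setT g ->
  (forall w, circle w -> `|g w| <= M) -> mu.-integrable circle (EFin \o g).
Proof.
move=> mg bg; apply: measurable_bounded_integrable.
- exact: measurable_unit_circle.
- by rewrite ltey_eq fin_num_measure //; exact: measurable_unit_circle.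
- exact: measurable_funTS.
- exists M; split; first exact: num_real.
  by move=> x Mx w cw; apply: le_trans (bg _ cw) (ltW Mx).
Qed.

Lemma integrable_Re f : circle_bounded f ->
  mu.-integrable circle (EFin \o (fun w => complex.Re (f w))).
Proof.
move=> [[mr _] [M bM]]; apply: (@integrable_bounded _ M) => // w cw.
exact: le_trans (Re_le_cabs _) (bM _ cw).
Qed.

Lemma integrable_Im f : circle_bounded f ->
  mu.-integrable circle (EFin \o (fun w => complex.Im (f w))).
Proof.
move=> [[_ mi] [M bM]]; apply: (@integrable_bounded _ M) => // w cw.
exact: le_trans (Im_le_cabs _) (bM _ cw).
Qed.

Lemma Cintegral_add f g : circle_bounded f -> circle_bounded g ->
  CI (fun w => f w + g w) = CI f + CI g.
Proof.
move=> bf bg; have mc := @measurable_unit_circle R.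
rewrite /Cintegral; apply/eqP; rewrite eq_complex /=; apply/andP; split; apply/eqP.
  rewrite -RintegralD //; [|exact: integrable_Re|exact: integrable_Re].
  by apply: eq_Rintegral => w _; rewrite Re_add.
rewrite -RintegralD //; [|exact: integrable_Im|exact: integrable_Im].
by apply: eq_Rintegral => w _; rewrite Im_add.
Qed.

Lemma Cintegral_scale c f : circle_bounded f -> CI (fun w => c * f w) = c * CI f.
Proof.
move=> bf; have mc := @measurable_unit_circle R.
have ir := integrable_Re bf; have ii := integrable_Im bf.
have iZ (r : R) (g : R * R -> R) : mu.-integrable circle (EFin \o g) ->
    mu.-integrable circle (EFin \o (fun w => r * g w)).
  by move=> ig; exact: (integrableZl mc r ig).
rewrite /Cintegral; apply/eqP; rewrite eq_complex Re_mul Im_mul /=.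
apply/andP; split; apply/eqP.
  rewrite -!RintegralZl // -RintegralB //; [|exact: iZ|exact: iZ].
  by apply: eq_Rintegral => w _; rewrite Re_mul.
rewrite -!RintegralZl // -RintegralD //; [|exact: iZ|exact: iZ].
by apply: eq_Rintegral => w _; rewrite Im_mul.
Qed.

Lemma circle_boundedD f g : circle_bounded f -> circle_bounded g ->
  circle_bounded (fun w => f w + g w).
Proof.
move=> [mf [M bM]] [mg [N bN]]; split; first exact: cmeasurableD.
exists (M + N) => w cw; apply: (le_trans (cabsD _ _)).
by apply: lerD; [exact: bM|exact: bN].
Qed.

Lemma circle_boundedZ c f : circle_bounded f -> circle_bounded (fun w => c * f w).
Proof.
move=> [mf [M bM]]; split; first by apply: cmeasurableM => //; exact: cmeasurable_cst.
by exists (cabs c * M) => w cw; rewrite cabsM ler_wpM2l ?cabs_ge0 // bM.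
Qed.

Lemma cabs_Cintegral_le f (b : R * R -> R) : circle_bounded f ->
  mu.-integrable circle (EFin \o b) ->
  (forall w, circle w -> cabs (f w) <= b w) ->
  cabs (CI f) <= 2 * \int[mu]_(w in circle) b w.
Proof.
move=> bf ib hb; have mc := @measurable_unit_circle R.
have ir := integrable_Re bf; have ii := integrable_Im bf.
apply: (le_trans (cabs_le_ReIm _)); rewrite /Cintegral /= mulrDl mul1r.
apply: lerD.
  apply: (le_trans (le_normr_Rintegral mc ir)); apply: le_Rintegral => //.
    exact: (integrable_norm ir).
  by move=> w cw; apply: le_trans (Re_le_cabs _) (hb _ cw).
apply: (le_trans (le_normr_Rintegral mc ii)); apply: le_Rintegral => //.
  exact: (integrable_norm ii).
by move=> w cw; apply: le_trans (Im_le_cabs _) (hb _ cw).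
Qed.

(** Differentiation under the integral sign: a uniform O(h^2) bound on the kernel
    survives integration against a finite measure. *)
Lemma Cintegral_expands (k k' : C -> R * R -> C) z (e M : R) : 0 < e -> 0 <= M ->
  (forall h, cabs h < e -> circle_bounded (k (z + h))) -> circle_bounded (k' z) ->
  (forall h w, cabs h < e -> circle w ->
     cabs (k (z + h) w - k z w - k' z w * h) <= M * cabs h ^+ 2) ->
  expands (fun x => CI (k x)) z (CI (k' z)).
Proof.
move=> e0 M0 bk bk' H; have mc := @measurable_unit_circle R.
exists (2 * (M * fine (mu circle))), e.
split; [by rewrite !mulr_ge0 // fine_ge0|by []|] => h he.
have bk0 : circle_bounded (k z) by rewrite -[z]addr0; apply: bk; rewrite cabs0.
have N1 f : circle_bounded f -> - CI f = CI (fun w => -1 * f w).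
  by move=> bf; rewrite Cintegral_scale // mulN1r.
rewrite [_ * h]mulrC -(Cintegral_scale h bk') !N1 //; last exact: circle_boundedZ.
have bkh := bk _ he.
have b1 := circle_boundedZ (-1) bk0.
have b2 := circle_boundedZ (-1) (circle_boundedZ h bk').
rewrite -(Cintegral_add bkh b1) -(Cintegral_add (circle_boundedD bkh b1) b2).
apply: (@le_trans _ _ (2 * \int[mu]_(w in circle) (M * cabs h ^+ 2))).
  apply: cabs_Cintegral_le; first exact: circle_boundedD (circle_boundedD bkh b1) b2.
    by apply: finite_measure_integrable_cst.
  by move=> w cw; rewrite !mulN1r [h * _]mulrC; exact: H.
by rewrite Rintegral_cst // [M * _ * _]mulrAC !mulrA.
Qed.

End CircleIntegral.

(** * The first two derivatives of a singular inner function *)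

Section SingularInner.
Variable R : realType.
Notation C := R[i].
Variable mu : {finite_measure set (R * R)%type -> \bar R}.
Notation circle := (@unit_circle R).
Notation CI := (@Cintegral R mu circle).
Implicit Types (z h : C) (w : R * R).

(** The kernel whose integral is the exponent of the singular inner function, and
    its first two derivatives in z. *)
Definition herglotz z w : C := (toC w + z) / (toC w - z).
Definition dherglotz z w : C := 2 * toC w / (toC w - z) ^+ 2.
Definition ddherglotz z w : C := 4 * toC w / (toC w - z) ^+ 3.

Lemma circle_sub_ge z w : circle w -> 1 - cabs z <= cabs (toC w - z).
Proof.
move=> cw; have := cabsD (toC w - z) z; rewrite subrK.
by rewrite [cabs (toC w)]cw; lra.
Qed.

Lemma circle_sub_neq0 z w : cabs z < 1 -> circle w -> toC w - z != 0.
Proof. by move=> z1 cw; rewrite -cabs_gt0; have := circle_sub_ge z cw; lra. Qed.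

Lemma cabsX z n : cabs (z ^+ n) = cabs z ^+ n.
Proof.
elim: n => [|n IHn]; first by rewrite !expr0 /cabs ComplexField.Normc.normc1.
by rewrite !exprS cabsM IHn.
Qed.

Lemma cabs_nat n : cabs (n%:R : C) = n%:R.
Proof. by rewrite -(rmorph_nat (real_complex R)) cabs_real ger0_norm. Qed.

Lemma cmeasurable_toC_id : cmeasurable (@toC R).
Proof. apply: (@cmeasurable_toC _ _ R id (@measurable_id _ _ setT)). Qed.

Lemma cmeasurable_sub z : cmeasurable (fun w => toC w - z).
Proof.
apply: cmeasurableD; first exact: cmeasurable_toC_id.
exact: cmeasurable_cst.
Qed.

Lemma herglotz_bounded z : cabs z < 1 -> circle_bounded (herglotz z).
Proof.
move=> z1; split.
  apply: cmeasurableM; last exact: cmeasurableV (cmeasurable_sub z).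
  by apply: cmeasurableD; [exact: cmeasurable_toC_id|exact: cmeasurable_cst].
exists (2 / (1 - cabs z)) => w cw; have := circle_sub_ge z cw => ge.
rewrite cabsM cabsV; apply: ler_pM; rewrite ?cabs_ge0 ?invr_ge0 ?cabs_ge0 //.
  by apply: (le_trans (cabsD _ _)); rewrite [cabs (toC w)]cw; lra.
by rewrite lef_pV2 ?posrE; lra.
Qed.

Lemma dherglotz_bounded z : cabs z < 1 -> circle_bounded (dherglotz z).
Proof.
move=> z1; split.
  apply: cmeasurableM.
    by apply: cmeasurableM; [exact: cmeasurable_cst|exact: cmeasurable_toC_id].
  apply: cmeasurableV; rewrite /GRing.exp /=; apply: cmeasurableM; exact: cmeasurable_sub.
exists (2 / (1 - cabs z) ^+ 2) => w cw; have := circle_sub_ge z cw => ge.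
rewrite !cabsM cabsV cabsX [cabs (toC w)]cw mulr1 cabs_nat ler_wpM2l //.
have e1 : 0 < 1 - cabs z by lra.
by rewrite lef_pV2 ?posrE ?exprn_gt0 ?ler_pXn2r ?nnegrE //; lra.
Qed.

Lemma ddherglotz_bounded z : cabs z < 1 -> circle_bounded (ddherglotz z).
Proof.
move=> z1; split.
  apply: cmeasurableM.
    by apply: cmeasurableM; [exact: cmeasurable_cst|exact: cmeasurable_toC_id].
  apply: cmeasurableV; rewrite /GRing.exp /=; apply: cmeasurableM; first exact: cmeasurable_sub.
  by apply: cmeasurableM; exact: cmeasurable_sub.
exists (4 / (1 - cabs z) ^+ 3) => w cw; have := circle_sub_ge z cw => ge.
rewrite !cabsM cabsV cabsX [cabs (toC w)]cw mulr1 cabs_nat ler_wpM2l //.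
have e1 : 0 < 1 - cabs z by lra.
by rewrite lef_pV2 ?posrE ?exprn_gt0 ?ler_pXn2r ?nnegrE //; lra.
Qed.

Lemma herglotz_expands z : cabs z < 1 ->
  expands (fun x => CI (herglotz x)) z (CI (dherglotz z)).
Proof.
move=> z1; pose r := 1 - cabs z; have r0 : 0 < r by rewrite subr_gt0.
apply: (@Cintegral_expands _ _ herglotz dherglotz z (r / 2) (4 / r ^+ 3)).
- lra.
- by rewrite divr_ge0 // exprn_ge0 // ltW.
- move=> h hr; apply: herglotz_bounded.
  by apply: (le_lt_trans (cabsD _ _)); rewrite /r in hr r0; lra.
- exact: dherglotz_bounded.
move=> h w hr cw.
have zh1 : cabs (z + h) < 1.
  by apply: (le_lt_trans (cabsD _ _)); rewrite /r in hr r0; lra.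
have a0 := circle_sub_neq0 z1 cw; have ah0 := circle_sub_neq0 zh1 cw.
have a1 : r <= cabs (toC w - z) := circle_sub_ge z cw.
have ah1 : r / 2 <= cabs (toC w - (z + h)).
  apply: le_trans (circle_sub_ge (z + h) cw).
  by have := cabsD z h; rewrite /r in hr r0 *; lra.
have -> : herglotz (z + h) w - herglotz z w - dherglotz z w * h =
    2 * toC w * h ^+ 2 * ((toC w - z) ^- 2 * (toC w - (z + h))^-1).
  by rewrite /herglotz /dherglotz; field; rewrite a0 ah0.
rewrite !cabsM !cabsV !cabsX cabs_nat [cabs (toC w)]cw mulr1 mulrAC ler_wpM2r ?sqr_ge0 //.
rewrite (_ : 4 / r ^+ 3 = 2 * (r ^- 2 * (r / 2)^-1)); last by field; rewrite gt_eqF.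
rewrite ler_wpM2l //; apply: ler_pM; rewrite ?invr_ge0 ?sqr_ge0 ?cabs_ge0 //.
  by rewrite lef_pV2 ?posrE ?exprn_gt0 ?ler_pXn2r ?nnegrE ?cabs_ge0 //; lra.
by rewrite lef_pV2 ?posrE //; lra.
Qed.

Lemma dherglotz_expands z : cabs z < 1 ->
  expands (fun x => CI (dherglotz x)) z (CI (ddherglotz z)).
Proof.
move=> z1; pose r := 1 - cabs z; have r0 : 0 < r by rewrite subr_gt0.
apply: (@Cintegral_expands _ _ dherglotz ddherglotz z (r / 2) (64 / r ^+ 5)).
- lra.
- by rewrite divr_ge0 // exprn_ge0 // ltW.
- move=> h hr; apply: dherglotz_bounded.
  by apply: (le_lt_trans (cabsD _ _)); rewrite /r in hr r0; lra.
- exact: ddherglotz_bounded.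
move=> h w hr cw.
have zh1 : cabs (z + h) < 1.
  by apply: (le_lt_trans (cabsD _ _)); rewrite /r in hr r0; lra.
have a0 := circle_sub_neq0 z1 cw; have ah0 := circle_sub_neq0 zh1 cw.
have a1 : r <= cabs (toC w - z) := circle_sub_ge z cw.
have ah1 : r / 2 <= cabs (toC w - (z + h)).
  apply: le_trans (circle_sub_ge (z + h) cw).
  by have := cabsD z h; rewrite /r in hr r0 *; lra.
have -> : dherglotz (z + h) w - dherglotz z w - ddherglotz z w * h =
    2 * toC w * h ^+ 2 * ((3 * (toC w - z) - 2 * h) * ((toC w - z) ^- 3 * (toC w - (z + h)) ^- 2)).
  by rewrite /dherglotz /ddherglotz; field; rewrite a0 ah0.
rewrite !cabsM !cabsV !cabsX cabs_nat [cabs (toC w)]cw mulr1 mulrAC ler_wpM2r ?sqr_ge0 //.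
rewrite (_ : 64 / r ^+ 5 = 2 * (8 * (r ^- 3 * (r / 2) ^- 2))); last by field; rewrite gt_eqF.
rewrite ler_wpM2l //; apply: ler_pM; rewrite ?mulr_ge0 ?invr_ge0 ?exprn_ge0 ?cabs_ge0 //.
  apply: (le_trans (cabsD _ _)); rewrite cabsN !cabsM !cabs_nat.
  have := cabsD (toC w) (- z); rewrite cabsN [cabs (toC w)]cw.
  by have := cabs_ge0 z; rewrite /r in hr; lra.
apply: ler_pM; rewrite ?invr_ge0 ?exprn_ge0 ?cabs_ge0 //;
  rewrite lef_pV2 ?posrE ?exprn_gt0 ?ler_pXn2r ?nnegrE ?cabs_ge0 //; lra.
Qed.

Notation S := (singular_inner mu).

Lemma singular_inner_expands z : cabs z < 1 ->
  expands S z (S z * - CI (dherglotz z)).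
Proof.
move=> z1; have H := expandsN (herglotz_expands z1).
exact: (expands_comp H (@cexp_expands R _)).
Qed.

Lemma cderiv_singular_inner z : cabs z < 1 ->
  cderiv S z = S z * - CI (dherglotz z).
Proof. by move=> /singular_inner_expands/expands_cderiv. Qed.

(** The derivative is the product of the function itself and an integral of the
    kernel dherglotz, both of which have quadratic expansions in the disk. *)
Lemma cderiv_singular_inner_expands z : cabs z < 1 ->
  exists d, expands (cderiv S) z d.
Proof.
move=> z1; have r0 : 0 < 1 - cabs z by rewrite subr_gt0.
eexists; apply: (@expands_near _ (fun x => S x * - CI (dherglotz x)) _ _ _ _ r0).
  move=> h hr; rewrite cderiv_singular_inner //.
  by apply: (le_lt_trans (cabsD _ _)); lra.
apply: expandsM; first exact: singular_inner_expands.
by apply: expandsN; exact: dherglotz_expands.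
Qed.

End SingularInner.

(** * Bounds by the potential of the measure *)

Section PoissonBounds.
Variable R : realType.
Notation C := R[i].
Variable mu : {finite_measure set (R * R)%type -> \bar R}.
Notation circle := (@unit_circle R).
Notation CI := (@Cintegral R mu circle).
Notation S := (singular_inner mu).
Implicit Types (z h : C) (w : R * R) (E : set (R * R)).

Definition inv_dist2 z w : R := (cabs (toC w - z) ^+ 2)^-1.

(** At a point of the circle off the support this is half the modulus of the angular
    derivative of the singular inner function. *)
Definition potential E z : R := \int[mu]_(w in E) inv_dist2 z w.

Lemma inv_dist2_ge0 z w : 0 <= inv_dist2 z w.
Proof. by rewrite invr_ge0 sqr_ge0. Qed.

Lemma measurable_inv_dist2 z : measurable_fun setT (inv_dist2 z).
Proof.
apply: measurable_invr_ge0; first by move=> w; exact: sqr_ge0.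
by apply: measurable_funX; apply: measurable_cabs; exact: cmeasurable_sub.
Qed.

Lemma Re_herglotz z w : circle w ->
  complex.Re (herglotz z w) = (1 - cabs z ^+ 2) * inv_dist2 z w.
Proof.
move=> cw; have w1 : cabs (toC w) ^+ 2 = 1 by rewrite [cabs (toC w)]cw expr1n.
rewrite /herglotz Re_mul Re_inv Im_inv /inv_dist2 -w1 !cabs2 !Re_add !Im_add !Re_opp !Im_opp.
by move: (_^-1) => i; ring.
Qed.

Lemma cabs_singular_inner z :
  cabs (S z) = expR (- \int[mu]_(w in circle) complex.Re (herglotz z w)).
Proof. by rewrite /singular_inner cabs_cexp Re_opp. Qed.

Lemma Re_herglotz_ge0 z w : cabs z < 1 -> circle w -> 0 <= complex.Re (herglotz z w).
Proof.
move=> z1 cw; rewrite Re_herglotz // mulr_ge0 ?inv_dist2_ge0 // subr_ge0.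
by rewrite expr_le1 ?cabs_ge0 // ltW.
Qed.

Lemma cabs_singular_inner_le1 z : cabs z < 1 -> cabs (S z) <= 1.
Proof.
move=> z1; rewrite cabs_singular_inner -expR0 ler_expR oppr_le0.
by apply: Rintegral_ge0 => w cw; exact: Re_herglotz_ge0.
Qed.

Lemma Rintegral_support E (g : R * R -> R) : closed E -> E `<=` circle ->
  mu (~` E) = 0%E -> mu.-integrable circle (EFin \o g) ->
  \int[mu]_(w in circle) g w = \int[mu]_(w in E) g w.
Proof.
move=> cE Ec muE ig; have mc := @measurable_unit_circle R.
have mE : measurable E by exact: closed_measurable_plane.
rewrite /Rintegral (negligible_integral (measurableC mE) mc ig muE).
by rewrite setDE setCK setIC (setIidl Ec).
Qed.

Lemma integrable_inv_dist2 E z (d : R) : closed E -> 0 < d ->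
  (forall w, E w -> d <= cabs (toC w - z)) ->
  mu.-integrable E (EFin \o inv_dist2 z).
Proof.
move=> cE d0 hd; have mE : measurable E by exact: closed_measurable_plane.
apply: measurable_bounded_integrable => //.
- by rewrite ltey_eq fin_num_measure.
- exact: measurable_funTS (measurable_inv_dist2 z).
- exists (d ^- 2); split; first exact: num_real.
  move=> x Mx w Ew; apply: le_trans (ltW Mx).
  rewrite ger0_norm ?inv_dist2_ge0 // lef_pV2 ?posrE ?exprn_gt0 ?(lt_le_trans d0 (hd _ Ew)) //.
  by rewrite ler_pXn2r ?nnegrE ?cabs_ge0 ?(ltW d0) // hd.
Qed.

Lemma potential_ge0 E z : 0 <= potential E z.
Proof. by apply: Rintegral_ge0 => w _; exact: inv_dist2_ge0. Qed.

Lemma inv_dist2_le z z' w (k : R) : 0 < cabs (toC w - z) ->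
  0 < cabs (toC w - z') -> 0 < k ->
  cabs (toC w - z') <= k * cabs (toC w - z) ->
  inv_dist2 z w <= k ^+ 2 * inv_dist2 z' w.
Proof.
move=> a0 b0 k0 h; rewrite /inv_dist2 -ler_pdivrMl ?exprn_gt0 // -invfM -exprMn.
by rewrite lef_pV2 ?posrE ?exprn_gt0 ?mulr_gt0 // ler_pXn2r // nnegrE ?mulr_ge0 ?cabs_ge0 // ltW.
Qed.

Lemma cabs_cis_sub_ray t (r : R) : 0 <= r <= 1 -> cabs (cis t - ((r%:C)%C : C) * cis t) = 1 - r.
Proof.
move=> hr; rewrite -[X in X - _]mul1r -mulrBl cabsM cabs_cis mulr1.
rewrite (_ : 1 - (r%:C)%C = ((1 - r)%:C)%C); last by rewrite rmorphB.
by rewrite cabs_real ger0_norm //; lra.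
Qed.

(** |S| <= 1, and moving from the circle to r e^(it) along a radius at most halves
    the distances to the points of E. *)
Lemma cabs_cderiv_singular_inner_le E t (r d : R) : closed E -> E `<=` circle -> mu (~` E) = 0%E ->
  0 < d -> (forall w, E w -> d <= cabs (toC w - cis t)) -> 0 <= r < 1 ->
  cabs (cderiv S ((r%:C)%C * cis t)) <= 16 * potential E (cis t).
Proof.
move=> cE Ec muE d0 hd hr; set z := (_ * cis t).
have mE : measurable E by exact: closed_measurable_plane.
have mc := @measurable_unit_circle R.
have zr : cabs z = r by rewrite cabs_ray //; lra.
have z1 : cabs z < 1 by lra.
have idz : mu.-integrable circle (EFin \o inv_dist2 z).
  apply: (@integrable_bounded _ _ _ ((1 - r) ^- 2)); first exact: measurable_inv_dist2.
  move=> w cw; have := circle_sub_ge z cw; rewrite zr => h.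
  have r0 : 0 < 1 - r by lra.
  rewrite ger0_norm ?inv_dist2_ge0 // lef_pV2 ?posrE ?exprn_gt0 ?(lt_le_trans r0 h) //.
  by rewrite ler_pXn2r ?nnegrE ?cabs_ge0 ?(ltW r0).
have idt := integrable_inv_dist2 cE d0 hd.
have i2 : mu.-integrable circle (EFin \o (fun w => 2 * inv_dist2 z w)).
  exact: (integrableZl mc 2 idz).
rewrite cderiv_singular_inner // cabsM cabsN.
apply: (@le_trans _ _ (1 * (2 * \int[mu]_(w in circle) (2 * inv_dist2 z w)))).
  apply: ler_pM; rewrite ?cabs_ge0 ?cabs_singular_inner_le1 //.
  apply: cabs_Cintegral_le => //; first exact: dherglotz_bounded.
  by move=> w cw; rewrite !cabsM cabsV cabsX [cabs (toC w)]cw mulr1 cabs_nat.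
rewrite mul1r (@Rintegral_support E) //.
apply: (@le_trans _ _ (2 * \int[mu]_(w in E) (8 * inv_dist2 (cis t) w))).
  rewrite ler_wpM2l //; apply: le_Rintegral => //.
  - exact: integrableS i2.
  - exact: (integrableZl mE 8 idt).
  move=> w Ew; rewrite (_ : 8 = 2 * 2 ^+ 2 :> R); last lra.
  rewrite -mulrA ler_wpM2l //.
  have g := circle_sub_ge z (Ec _ Ew); rewrite zr in g.
  apply: inv_dist2_le; [lra|exact: lt_le_trans (hd _ Ew)|lra|].
  apply: (le_trans (@cabs_triangle R z _ _)).
  by rewrite [cabs (z - _)]cabsC cabs_cis_sub_ray; lra.
by rewrite RintegralZl // /potential; lra.
Qed.

(** In the square the distances to E are comparable with those from e^(it), as
    2^-n <= d; so - log |S|, the Poisson integral of the measure, is at least 2^-n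
    times the potential divided by 8. *)
Lemma cabs_singular_inner_box E t n v (d : R) : closed E -> E `<=` circle ->
  mu (~` E) = 0%E -> 0 < d -> (forall w, E w -> d <= cabs (toC w - cis t)) ->
  dyad R n <= d -> 8 <= dyad R n * potential E (cis t) -> box n t v ->
  unit_disk v /\ cabs (S (toC v)) <= 1 / 2.
Proof.
move=> cE Ec muE d0 hd nd big bv; have h0 := dyad_gt0 R n; have h1 := dyad_le1 R n.
have mE : measurable E by exact: closed_measurable_plane.
have mc := @measurable_unit_circle R.
have /andP[a1 a2] := box_annulus bv; have bn := box_near bv.
have v1 : cabs (toC v) < 1 by lra.
split => //; rewrite cabs_singular_inner.
have ih := integrable_Re mu (@herglotz_bounded R (toC v) v1).
have idt := integrable_inv_dist2 cE d0 hd.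
rewrite (@Rintegral_support E) //.
have low : 1 <= \int[mu]_(w in E) complex.Re (herglotz (toC v) w).
  apply: (@le_trans _ _ (\int[mu]_(w in E) (dyad R n / 8 * inv_dist2 (cis t) w))).
    rewrite RintegralZl //; move: big; rewrite /potential; lra.
  apply: le_Rintegral => //.
  - exact: (integrableZl mE _ idt).
  - exact: integrableS ih.
  move=> w Ew; rewrite Re_herglotz; last exact: Ec.
  have g := circle_sub_ge (toC v) (Ec _ Ew).
  have hw := hd _ Ew.
  (* 9/4 = 1 + 1 + 1/4: from w to e^(it), to the centre of the square, to v *)
  have far : cabs (toC w - toC v) <= 9 / 4 * cabs (toC w - cis t).
    have := @cabs_triangle R (cis t) (toC w) (toC v).
    have := @cabs_triangle R (((1 - dyad R n)%:C)%C * cis t) (cis t) (toC v).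
    rewrite cabs_cis_sub_ray ?[cabs (_ * cis t - _)]cabsC; lra.
  have h : inv_dist2 (cis t) w <= (9 / 4) ^+ 2 * inv_dist2 (toC v) w.
    by apply: inv_dist2_le far; lra.
  have i0 := inv_dist2_ge0 (toC v) w.
  have vv : 3 / 4 * dyad R n <= 1 - cabs (toC v) ^+ 2 by have := cabs_ge0 (toC v); nra.
  apply: (@le_trans _ _ (3 / 4 * dyad R n * inv_dist2 (toC v) w)); last by rewrite ler_wpM2r.
  apply: (@le_trans _ _ (dyad R n / 8 * ((9 / 4) ^+ 2 * inv_dist2 (toC v) w))).
    by rewrite ler_wpM2l //; lra.
  have : 0 <= dyad R n * inv_dist2 (toC v) w by rewrite mulr_ge0 // ltW.
  lra.
have e2 : 2 <= expR (\int[mu]_(w in E) complex.Re (herglotz (toC v) w)).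
  apply: le_trans (expR_ge1Dx _); lra.
by rewrite expRN div1r lef_pV2 ?posrE ?expR_gt0.
Qed.

End PoissonBounds.

(** * The pointwise estimate and its integral *)

Section Assembly.
Variable R : realType.
Notation C := R[i].
Notation lambda := (@lebesgue_measure R).
Notation lambda2 := (@plane_measure R).
Notation dyad := (dyad R).
Variable mu : {finite_measure set (R * R)%type -> \bar R}.
Notation circle := (@unit_circle R).
Notation S := (singular_inner mu).

(** If Q < 8, then the first term is large enough, since d <= 2. Otherwise take n
    largest with 8 <= 2^-n Q, so that Q is comparable with 2^n. Either
    2^-n <= d, and the n-th term of the sum is of size Q^p, or 1 / d is larger than
    2^n and d^-p does the job. *)
Lemma powR_dyadic_cover (Q d p : R) (G : nat -> \bar R) : 0 < p < 1 -> 0 <= Q ->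
  0 < d <= 2 -> (forall n, (0 <= G n)%E) ->
  (forall n, dyad n <= d -> 8 <= dyad n * Q -> (1 <= G n)%E) ->
  ((Q `^ p)%:E <= 16%:E * ((d `^ (- p))%:E + \sum_(n <oo) ((dyad n `^ (- p))%:E * G n)))%E.
Proof.
move=> /andP[p0 p1] Q0 /andP[d0 d2] G0 HG.
have term0 n : (0 <= (dyad n `^ (- p))%:E * G n)%E by rewrite mule_ge0 // lee_fin powR_ge0.
have sum0 : (0 <= \sum_(n <oo) ((dyad n `^ (- p))%:E * G n))%E by exact: nneseries_ge0.
have scale x : 0 < x -> Q <= 16 / x -> Q `^ p <= 16 * x `^ (- p).
  move=> x0 Qx; apply: (@le_trans _ _ ((16 / x) `^ p)).
    by apply: ge0_ler_powR; rewrite ?nnegrE ?divr_ge0 // ltW.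
  rewrite powRM ?invr_ge0 ?(ltW x0) // -(powR_inv1 (ltW x0)) -powRrM mulN1r.
  by rewrite ler_wpM2r ?powR_ge0 //; apply: ler1_powR; lra.
have use_d : Q <= 16 / d -> ((Q `^ p)%:E <= 16%:E * ((d `^ (- p))%:E +
    \sum_(n <oo) ((dyad n `^ (- p))%:E * G n)))%E.
  move=> /(scale _ d0) h; apply: (@le_trans _ _ (16%:E * (d `^ (- p))%:E)%E).
    by rewrite -EFinM lee_fin.
  by apply: lee_wpmul2l => //; rewrite leeDl.
have [Q8|Q8] := ltP Q 8.
  apply: use_d; rewrite ler_pdivlMr //; apply: (@le_trans _ _ (8 * 2)); last lra.
  by apply: ler_pM => //; lra.
have Qpos : 0 < Q by lra.
have ex : exists k, dyad k * Q < 8.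
  have [|k hk] := @dyad_small R (7 / Q); first by rewrite divr_gt0.
  by exists k; apply: (@le_lt_trans _ _ 7); [rewrite -ler_pdivlMr|lra].
have [[|n] hn nmin] := ex_minnP ex; first by exfalso; move: hn; rewrite dyad0; lra.
have n8 : 8 <= dyad n * Q.
  by rewrite leNgt; apply/negP => /nmin; rewrite ltnn.
have h0 := dyad_gt0 R n.
have Qn : Q <= 16 / dyad n.
  by rewrite ler_pdivlMr // mulrC; move: hn; rewrite dyadS; lra.
have [nd|dn] := leP (dyad n) d; last first.
  apply: use_d; apply: (le_trans Qn); rewrite ler_wpM2l // lef_pV2 ?posrE //; exact: ltW.
apply: (@le_trans _ _ (16%:E * ((dyad n `^ (- p))%:E * G n))%E).
  apply: (@le_trans _ _ (16 * dyad n `^ (- p))%:E); first by rewrite lee_fin; exact: scale.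
  rewrite EFinM; apply: lee_wpmul2l => //.
  by rewrite -[leLHS]mule1; apply: lee_wpmul2l; [rewrite lee_fin powR_ge0|exact: HG].
apply: lee_wpmul2l => //; apply: (le_trans (@nneseries_term _ _ n term0)).
by rewrite leeDr // lee_fin powR_ge0.
Qed.

Definition sublevel (c : R) : set (R * R) :=
  [set w | unit_disk w /\ cabs (S (toC w)) < c].

(** On the disk - log |S| is the integral of a nonnegative kernel in one of its two
    variables, hence measurable by Tonelli. *)
Lemma measurable_sublevel c : measurable (sublevel c).
Proof.
have mD := @measurable_unit_disk R; have mC := @measurable_unit_circle R.
pose k (x : (R * R) * (R * R)) : R :=
  \1_(@unit_disk R) x.1 * (\1_circle x.2 *
    ((1 - cabs (toC x.1) ^+ 2) * (cabs (toC x.2 - toC x.1) ^+ 2)^-1)).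
have k0 x : 0 <= k x.
  rewrite /k; have [d1|nd] := pselect (unit_disk x.1); last first.
    by rewrite indicE memNset // mul0r.
  rewrite mulr_ge0 // mulr_ge0 // mulr_ge0 ?invr_ge0 ?sqr_ge0 //.
  by rewrite subr_ge0 expr_le1 ?cabs_ge0 // ltW.
have mk : measurable_fun setT k.
  have i1 : measurable_fun setT (\1_(@unit_disk R) : R * R -> R) by exact: measurable_indic.
  have i2 : measurable_fun setT (\1_circle : R * R -> R) by exact: measurable_indic.
  have m1 : measurable_fun setT (fun x : (R * R) * (R * R) => cabs (toC x.1)).
    exact: (measurableT_comp (@measurable_cabs_toC R) measurable_fst).
  have m2 : measurable_fun setT (fun x : (R * R) * (R * R) => cabs (toC x.2 - toC x.1)).
    apply: measurable_cabs; apply: cmeasurableD; first exact: cmeasurable_toC.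
    by apply: cmeasurableN; exact: cmeasurable_toC.
  apply: measurable_funM.
    exact: (measurableT_comp i1 measurable_fst).
  apply: measurable_funM.
    exact: (measurableT_comp i2 measurable_snd).
  apply: measurable_funM.
    by apply: measurable_funB => //; exact: measurable_funX.
  apply: measurable_invr_ge0; first by move=> x; exact: sqr_ge0.
  exact: measurable_funX.
have mF : measurable_fun setT (fubini_F mu (fun x => (k x)%:E)).
  apply: measurable_fun_fubini_tonelli_F; first exact/measurable_EFinP.
  by move=> x; rewrite lee_fin.
have FE z : unit_disk z ->
    fine (fubini_F mu (fun x => (k x)%:E) z) =
      \int[mu]_(w in circle) complex.Re (herglotz (toC z) w).
  move=> dz; congr fine; rewrite /fubini_F [RHS]integral_mkcond; apply: eq_integral => w _.
  rewrite /k /patch [\1_(@unit_disk R) _]indicE /= mem_set // mul1r indicE.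
  case: ifPn => [/set_mem cw|_]; last by rewrite mul0r.
  rewrite mul1r; congr EFin; exact: (esym (Re_herglotz (toC z) cw)).
rewrite (_ : sublevel c = @unit_disk R `&`
   [set z | expR (- fine (fubini_F mu (fun x => (k x)%:E) z)) < c]).
  apply: measurableI => //; apply: measurable_set_ltr => //.
  apply: (measurableT_comp (continuous_measurable_fun (@continuous_expR R))).
  apply: measurableT_comp => //.
  exact: (measurableT_comp (fine_measurable measurableT) mF).
by apply/seteqP; split => z [dz h]; split => //; move: h; rewrite /= FE // cabs_singular_inner.
Qed.

Lemma circ_dist_le2 E t : E `<=` circle -> E !=set0 -> circ_dist E t <= 2.
Proof.
move=> Ec [w Ew]; apply: (le_trans (circ_dist_le _ Ew)); apply: (le_trans (cabsD _ _)).
by rewrite cabsN cabs_cis [cabs (toC w)](Ec _ Ew); lra.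
Qed.

Local Open Scope ereal_scope.

Lemma cabs_cderiv_powR_le E t r p : (0 < p < 1)%R -> closed E -> E `<=` circle -> E !=set0 ->
  mu (~` E) = 0 -> (0 < circ_dist E t)%R -> (0 <= r < 1)%R ->
  ((cabs (cderiv S ((r%:C)%C * cis t)) `^ p)%R)%:E <=
  256%:E * (((circ_dist E t `^ (- p))%R)%:E +
    \sum_(n <oo) (((dyad n `^ (- p))%R)%:E * box_density (sublevel (3 / 4)) n t)).
Proof.
move=> hp cE Ec E0 muE d0 hr.
have hd w : E w -> (circ_dist E t <= cabs (toC w - cis t))%R.
  by move=> Ew; rewrite cabsC; exact: circ_dist_le.
have cover : ((potential mu E (cis t) `^ p)%R)%:E <=
    16%:E * (((circ_dist E t `^ (- p))%R)%:E +
    \sum_(n <oo) (((dyad n `^ (- p))%R)%:E * box_density (sublevel (3 / 4)) n t)).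
  apply: powR_dyadic_cover => //.
  - exact: potential_ge0.
  - by rewrite d0 circ_dist_le2.
  - by move=> n; exact: box_density_ge0.
  move=> n nd big; apply: box_density_ge1 => v bv.
  have [dv hv] := cabs_singular_inner_box cE Ec muE d0 hd nd big bv.
  by split => //; apply: (le_lt_trans hv); lra.
apply: (@le_trans _ _ (16%:E * ((potential mu E (cis t) `^ p)%R)%:E)).
  rewrite -EFinM lee_fin; apply: (@le_trans _ _ ((16 * potential mu E (cis t)) `^ p)%R).
    apply: ge0_ler_powR; rewrite ?nnegrE ?cabs_ge0 ?mulr_ge0 ?potential_ge0 //; first lra.
    exact: (cabs_cderiv_singular_inner_le cE Ec muE d0 hd hr).
  rewrite powRM ?potential_ge0 // ler_wpM2r ?powR_ge0 //; apply: ler1_powR; lra.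
apply: (le_trans (lee_wpmul2l _ cover)) => //.
by rewrite muleA -EFinM (_ : (16 * 16 = 256 :> R)%R); last lra.
Qed.

Lemma closed_circ_dist_gt0 E t : closed E -> E `<=` circle -> E !=set0 ->
  (0 <= t < 2 * pi)%R -> ~ E (circ t) -> (0 < circ_dist E t)%R.
Proof.
move=> cE Ec E0 ht nE; have [J cJ Jt] := circ_complementary_arc nE.
have [_ _ [a [b H]]] := complementary_arc_data cE Ec E0 cJ.
have /andP[m0 mE] := H t (conj ht Jt).
exact: lt_le_trans m0 mE.
Qed.

(** The majorant is made infinite on the null set formed by the angles of E and the
    endpoint 2 pi; elsewhere it is the one of the pointwise estimate. *)
Lemma singular_inner_derivative_bound E p : (0 < p < 1)%R ->
  beurling_carleson (1 - p)%R E -> mu (~` E) = 0 -> E !=set0 ->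
  \int[lambda2]_(w in sublevel (3 / 4)) (((1 - cabs (toC w)) `^ (1 + p))^-1)%R%:E < +oo ->
  exists2 M : \bar R, M < +oo & forall r, (0 <= r < 1)%R ->
    \int[lambda]_(t in `[0%R, (2 * pi)%R])
      ((cabs (cderiv S ((r%:C)%C * cis t)) `^ p)%R)%:E <= M.
Proof.
move=> hp bcE muE E0 Sfin; have [Ec cE lE _] := bcE; have /andP[p0 p1] := hp.
have E2 : (2 * pi = pi *+ 2 :> R)%R by rewrite mulr_natl.
pose I : set R := `[0%R, (2 * pi)%R]%classic.
have mI : measurable I by exact: measurable_itv.
pose N := arc_angles E `|` [set (2 * pi)%R].
have mE := measurable_arc_angles cE.
have mN : measurable N by apply: measurableU => //; exact: measurable_set1.
have N0 : lambda N = 0.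
  apply/eqP; rewrite eq_le measure_ge0 andbT.
  apply: (le_trans (measureU2 _ _ _)); [exact: mE|exact: measurable_set1|].
  rewrite [X in X + _](_ : _ = 0) // [X in _ + X](_ : _ = 0) ?adde0 //.
  exact: lebesgue_measure_set1.
pose f t : \bar R := ((circ_dist E t `^ (- p))%R)%:E.
pose g t := \sum_(n <oo) (((dyad n `^ (- p))%R)%:E * box_density (sublevel (3 / 4)) n t).
pose H t := 256%:E * (f t + g t) + +oo * (\1_N t)%:E.
have f0 t : 0 <= f t by rewrite lee_fin powR_ge0.
have g0 t : 0 <= g t.
  by apply: nneseries_ge0 => n _ _; rewrite mule_ge0 ?lee_fin ?powR_ge0 // box_density_ge0.
have mf D : measurable_fun D f.
  apply: (measurable_funS _ (subsetT D)) => //; apply/measurable_EFinP.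
  apply: (measurableT_comp (measurable_powR _)).
  by apply: continuous_measurable_fun; exact: continuous_circ_dist.
have mg : measurable_fun I g.
  rewrite /I E2; apply: measurable_fun_nneseries.
    by move=> n t; rewrite mule_ge0 ?lee_fin ?powR_ge0 // box_density_ge0.
  by move=> n; apply: measurable_funeM; apply: measurable_box_density; exact: measurable_sublevel.
exists (\int[lambda]_(t in I) H t); last first.
  move=> r hr; apply: le_integral_pointwise => t; first by rewrite lee_fin powR_ge0.
  rewrite /= in_itv /= => ht; rewrite /H.
  have [Nt|Nt] := pselect (N t).
    rewrite indicE mem_set // mule1 addey ?leey //.
    by rewrite -ltNye (@lt_le_trans _ _ 0) // mule_ge0 // adde_ge0.
  rewrite indicE memNset // mule0 adde0.
  have t2 : (0 <= t < 2 * pi)%R.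
    case/andP: ht => -> /=; rewrite le_eqVlt => /predU1P[tE|//].
    by case: Nt; right.
  apply: cabs_cderiv_powR_le => //.
  by apply: closed_circ_dist_gt0 => // Et; apply: Nt; left.
have mfg : measurable_fun I (fun t => f t + g t) by apply: emeasurable_funD => //; exact: mf.
have mi : measurable_fun I (fun t => (\1_N t : R)%:E).
  by apply/measurable_EFinP/measurable_funTS; apply: measurable_indic.
have fg0 t : I t -> 0 <= f t + g t by move=> _; rewrite adde_ge0.
have i0 t : I t -> 0 <= (\1_N t : R)%:E by move=> _; rewrite lee_fin.
have -> : \int[lambda]_(t in I) H t =
    \int[lambda]_(t in I) (256%:E * (f t + g t)) +
    \int[lambda]_(t in I) (+oo * (\1_N t)%:E).
  apply: ge0_integralD; first exact: mI.
  - by move=> t It; apply: mule_ge0 => //; exact: fg0.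
  - exact: measurable_funeM.
  - by move=> t It; apply: mule_ge0 => //; exact: i0.
  - exact: measurable_funeM.
have -> : \int[lambda]_(t in I) (+oo * (\1_N t)%:E) = 0.
  rewrite (@ge0_integralZl _ _ _ lambda I mI _ mi +oo i0) //.
  rewrite integral_indic; [|exact: mI|exact: mN].
  rewrite [X in _ * X](_ : _ = 0) ?mule0 //.
  apply/eqP; rewrite eq_le measure_ge0 andbT -N0.
  by apply: le_measure; rewrite ?inE; [exact: measurableI|exact: mN|exact: subIsetl].
have -> : \int[lambda]_(t in I) (256%:E * (f t + g t)) =
    256%:E * (\int[lambda]_(t in I) f t + \int[lambda]_(t in I) g t).
  rewrite (@ge0_integralZl _ _ _ lambda I mI _ mfg 256%:E fg0) ?lee_fin //; congr (_ * _).
  by apply: ge0_integralD => //; exact: mf.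
rewrite adde0 lte_mul_pinfty ?lee_fin //; apply: lte_add_pinfty.
  rewrite -integral_itv_bndo_bndc; last exact: mf.
  exact: integral_circ_dist_lty.
rewrite /I E2; apply: integral_sum_box_density => //; exact: measurable_sublevel.
Qed.

End Assembly.

Theorem lemma6p1 (R : realType) (p : R) (hp : 0 < p < 1 / 2)
    (mu : {finite_measure set (R * R)%type -> \bar R}) (E : set (R * R)%type)
    (hE : beurling_carleson (1 - p) E) (hmu : mu (~` E) = 0%E)
    (hS : area_condition (1 + p) (singular_inner mu)) :
  hardy p (cderiv (singular_inner mu)).
Proof.
have hp1 : 0 < p < 1 by lra.
have [Ec cE lE _] := hE.
split.
  move=> z z1; have [d] := cderiv_singular_inner_expands mu z1.
  exact: expands_derivable.
have [M M1 HM] : exists2 M : \bar R, (M < +oo)%E & forall r, 0 <= r < 1 ->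
    (\int[@lebesgue_measure R]_(t in `[0%R, (2 * pi)%R])
      ((cabs (cderiv (singular_inner mu) ((r%:C)%C * cis t)) `^ p)%R)%:E <= M)%E.
  have [E0|/set0P E0] := eqVneq E set0; last first.
    apply: (singular_inner_derivative_bound hp1 hE hmu E0).
    have c1 : 0 < (3 / 4 : R) < 1 by lra.
    exact: (hS _ c1).
  (* If E is empty, then mu = 0 and S' = 0. *)
  exists 0%E => // r hr; rewrite integral0_eq // => t _.
  have := @cabs_cderiv_singular_inner_le R mu E t r 1 cE Ec hmu ltr01.
  rewrite E0 /potential Rintegral_set0 mulr0 => /(_ (fun w => False_ind _) hr) h.
  have -> : cabs (cderiv (singular_inner mu) ((r%:C)%C * cis t)) = 0.
    by apply/eqP; rewrite eq_le h cabs_ge0.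
  by rewrite powR0 //; lra.
apply: (le_lt_trans _ M1); apply: ge_ereal_sup => _ [r hr <-].
exact: HM.
Qed.
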